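(* Let $t>1$ and $\tau>2$, and put $\beta=\tau-1>1$ and $s=t\beta$. For $r\ge0$ define $x_r=[0;a_1,a_2,\dots]$ recursively by $$a_1=2,\qquad a_{k+1}=\Bigl\lceil\frac{q_k^{\,\beta-1}}{(k+1)^{r/t}}\Bigr\rceil\quad(k\ge1),$$ where $q_k$ are the convergent denominators determined by $q_{-1}=0$, $q_0=1$, $q_{k+1}=a_{k+1}q_k+q_{k-1}$. Then $x_r$ is a well-defined irrational number with, as $k\to\infty$, $$\frac{q_{k+1}^{\,t}}{q_k^{\,s}}=\frac{1}{(k+1)^{r}}\bigl(1+o(1)\bigr),\qquad \frac{\log q_{k+1}}{\log q_k}\longrightarrow\beta,$$ so that $\mu(x_r)=\tau$ for every $r\ge0$, while $$\mathcal F_{s,t}(x_r)<\infty\iff r>1.$$ In particular $x_2$ and $x_1$ both have irrationality exponent exactly $\tau$, and $\mathcal F_{s,t}(x_2)<\infty$ while $\mathcal F_{s,t}(x_1)=\infty$. Moreover the summands of $\mathcal F_{s,t}(x_r)$ tend to $0$ for every $r>0$, whereas for $r=0$ they do not: for $q_k\le n<q_{k+1}$ one has $\lVert nx_r\rVert\ge\lVert q_kx_r\rVert>1/(q_{k+1}+q_k)$, hence $$\frac{1}{n^{s}|\sin(\pi nx_r)|^{t}}\le\frac{(q_{k+1}+q_k)^{t}}{2^{t}q_k^{\,s}}=O\bigl((k+1)^{-r}\bigr),$$ which tends to $0$ when $r>0$. For $r=0$, at $n=q_k$, $$\frac{1}{q_k^{\,s}|\sin(\pi q_kx_0)|^{t}}\ge\pi^{-t}\frac{1}{q_k^{\,s}\lVert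 q_kx_0\rVert^{t}}>\pi^{-t}\frac{q_{k+1}^{t}}{q_k^{\,s}}\longrightarrow\pi^{-t},$$ and in fact the terms at $n=q_k$ converge to $\pi^{-t}$ as $k\to\infty$. Along $m_k=q_k+1$ one has $\lVert m_kx_0\rVert\to\lVert x_0\rVert>0$, so the terms at $n=m_k$ tend to $0$. The sequence of summands of $\mathcal F_{s,t}(x_0)$ therefore has the two subsequential limits $\pi^{-t}$ and $0$ and does not converge.
   Context: For irrational $x$, $\mathcal F_{s,t}(x)=\sum_{n\ge1}n^{-s}|\sin(\pi nx)|^{-t}\in[0,\infty]$; its summands are the terms $n^{-s}|\sin(\pi nx)|^{-t}$, $n\ge1$. $\lVert y\rVert=\min_{m\in\mathbb Z}|y-m|$. $[0;a_1,a_2,\dots]$ denotes the continued fraction with partial quotients $a_k$. The irrationality exponent is $\mu(x)=\inf\{\tau>0: |x-p/q|<q^{-\tau}\text{ for at most finitely many } p/q\in\mathbb Q\}$. *)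

(* Defs.v *)
From HB Require Import structures.
From mathcomp Require Import all_boot all_order all_algebra.
From mathcomp Require Import all_classical all_reals all_analysis.

Set Implicit Arguments.
Unset Strict Implicit.
Unset Printing Implicit Defensive.

Import Order.TTheory GRing.Theory Num.Theory.
Import numFieldNormedType.Exports.

Local Open Scope classical_set_scope.
Local Open Scope ring_scope.

Section SineSeries.
Context {R : realType}.
Implicit Types (s t x : R).

Definition summand s t x : R^nat :=
  fun n => n%:R `^ (- s) * `|sin (pi * n%:R * x)| `^ (- t).

Definition sine_series s t x : \bar R :=
  (\sum_(1 <= n <oo) (summand s t x n)%:E)%E.

End SineSeries.

Section Diophantine.
Context {R : realType}.
Implicit Types (x y : R).

(* The infimum is a minimum: see dist_int_min. *)
Definition dist_int y : R := inf [set `|y - m%:~R| | m in [set: int]].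

Lemma dist_int_min y :
  exists m : int, dist_int y = `|y - m%:~R| /\
    forall m' : int, `|y - m%:~R| <= `|y - m'%:~R|.
Proof.
have [m hm] : exists m : int, forall m' : int, `|y - m%:~R| <= `|y - m'%:~R|.
  pose f := Num.floor y; pose mf := `|y - f%:~R|; pose mc := `|y - (f + 1)%:~R|.
  have fle : f%:~R <= y by exact: floor_le.
  have ltf : y < (f + 1)%:~R by exact: floorD1_gt.
  have near m' : mf <= `|y - m'%:~R| \/ mc <= `|y - m'%:~R|.
    have [le_m'|lt_m'] := lerP m' f; [left|right].
      have le1 : m'%:~R <= f%:~R :> R by rewrite ler_int.
      rewrite /mf !ger0_norm ?subr_ge0 ?lerD2l ?lerN2 //.
      exact: le_trans le1 fle.
    have le1 : (f + 1)%:~R <= m'%:~R :> R by rewrite ler_int lezD1.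
    rewrite /mc !ler0_norm ?subr_le0 ?lerN2 ?lerD2l ?lerN2 ?(ltW ltf) //.
    exact: le_trans (ltW ltf) le1.
  have [le_fc|/ltW le_cf] := lerP mf mc.
    exists f => m'; have [//|] := near m'; exact: le_trans.
  exists (f + 1) => m'; have [|//] := near m'; exact: le_trans.
exists m; split=> //; apply/eqP; rewrite eq_le; apply/andP; split.
  apply: ge_inf; last by exists m.
  by exists 0 => _ [m' _ <-].
by apply: lb_le_inf; [exists `|y - m%:~R|, m|move=> _ [m' _ <-]].
Qed.

(* Rationals are counted in lowest terms: each fraction p/q has the same value
   as its reduced form, which satisfies the condition whenever p/q does. *)
Definition irrationality_exponent x : \bar R :=
  ereal_inf (EFin @` [set tau : R | 0 < tau /\
    finite_set [set p : rat | `|x - ratr p| < (denq p)%:~R `^ (- tau)]]).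

End Diophantine.

Section ContinuedFraction.
Context {R : realType}.

(* [0; a 1, ..., a n]; the value a 0 is not used. *)
Definition cf_convergent (a : nat -> nat) : R^nat :=
  fun n => foldr (fun k y => ((a k)%:R + y)^-1) 0 (iota 1 n).

(* [0; a 1, a 2, ...]; meaningful when the convergents converge. *)
Definition cf_value (a : nat -> nat) : R := limn (cf_convergent a).

End ContinuedFraction.

Section Construction.
Context {R : realType}.
Variables (t beta r : R).

(* The partial quotient a_(k+1) as a function of k and q = q_k; the ceiling is
   that of a nonnegative real, so taking its absolute value is harmless. *)
Definition next_quotient (k q : nat) : nat :=
  if k is 0 then 2
  else `|Num.ceil (q%:R `^ (beta - 1) / (k.+1)%:R `^ (r / t))|%N.

(* The pair (q_k, q_(k-1)). *)
Fixpoint denominator_pair (k : nat) : nat * nat :=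
  if k is k'.+1 then
    let: (q, q') := denominator_pair k' in (next_quotient k' q * q + q', q)%N
  else (1, 0)%N.

Definition denominator (k : nat) : nat := (denominator_pair k).1.

Definition partial_quotient (k : nat) : nat :=
  if k is k'.+1 then next_quotient k' (denominator k') else 0.

Definition xr : R := cf_value partial_quotient.

Lemma partial_quotient1 : partial_quotient 1 = 2.
Proof. by []. Qed.

Lemma partial_quotientS k : (0 < k)%N ->
  (partial_quotient k.+1)%:Z =
  Num.ceil ((denominator k)%:R `^ (beta - 1) / (k.+1)%:R `^ (r / t)).
Proof.
case: k => // k _; rewrite /partial_quotient /next_quotient gez0_abs //.
rewrite ceil_ge0; apply: (@lt_le_trans _ _ 0); first by rewrite ltrN10.
by rewrite divr_ge0 ?powR_ge0.
Qed.

Lemma denominator0 : denominator 0 = 1.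
Proof. by []. Qed.

Lemma denominator1 : denominator 1 = partial_quotient 1.
Proof. by []. Qed.

Lemma denominatorSS k :
  denominator k.+2 = (partial_quotient k.+2 * denominator k.+1 + denominator k)%N.
Proof.
rewrite /partial_quotient /denominator /=.
by case: (denominator_pair k) => q q'.
Qed.

End Construction.

Definition subsequential_limit {R : realType} (u : R^nat) (l : R) : Prop :=
  exists2 phi : nat -> nat,
    {homo phi : m n / (m < n)%N} & u (phi n) @[n --> \oo] --> l.

(* Main.v *)
(** With p_k / q_k the convergents of x, the errors |q_k x - p_k| are best
    approximation distances and lie between 1 / (q_(k+1) + q_k) and 1 / q_(k+1).
    The recursion for a_(k+1) makes q_(k+1)^t / q_k^s equal to (k+1)^(-r) up to
    a factor tending to 1, because q_k grows at least geometrically and so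
    dominates every power of k; this gives both the irrationality exponent and
    the size of the term n = q_k.  All the terms of a block q_k <= n < q_(k+1)
    together are of that same order: the points n x in the block are separated
    modulo 1 by |q_k x - p_k|, so the sum of the ||n x||^(-t) is at most
    2 zeta(t) |q_k x - p_k|^(-t).  The series is therefore comparable with the
    series of the (k+1)^(-r). *)
Require Import Defs.
From HB Require Import structures.
From mathcomp Require Import all_boot all_order all_algebra.
From mathcomp Require Import all_classical all_reals all_analysis.
From mathcomp Require Import ring lra zify.

Set Implicit Arguments.
Unset Strict Implicit.
Unset Printing Implicit Defensive.

Import Order.TTheory GRing.Theory Num.Theory.
Import numFieldNormedType.Exports.

Local Open Scope classical_set_scope.
Local Open Scope ring_scope.

(** * Continued fractions *)

(** The choice s = t * beta is critical: it cancels the powers of q_k in q_(k+1)^t / q_k^s and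
    leaves only (k+1)^(-r). A power of k is negligible on the scale of log q_k, so the irrationality
    exponent cannot see r, whereas summability over k depends on it. A block has q_(k+1) - q_k
    terms, so bounding each by the largest possible one is useless for the sum; separation together
    with t > 1 removes the length of the block. For divergence one term per block, n = q_k, is
    enough. The limit pi^(-t) at r = 0 needs more than comparability, hence two lower bounds for the
    sine: the chord bound, and y cos y <= sin y, which is sharp at 0. *)

Section Convergents.
Context {R : realType}.
Variable a : nat -> nat.
Hypothesis a_gt0 : forall k, (0 < k)%N -> (0 < a k)%N.

(** Numerators and denominators obey one recurrence and differ only in their initial values.
    Starting at the indices 0 and 1 avoids the index -1. *)
Fixpoint continuant (u0 u1 n : nat) : nat :=
  match n with
  | 0 => u0
  | n'.+1 => match n' with
             | 0 => u1
             | n''.+1 => (a n * continuant u0 u1 n' + continuant u0 u1 n'')%N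
             end
  end.

Definition cf_num : nat -> nat := continuant 0 1.
Definition cf_den : nat -> nat := continuant 1 (a 1).

Lemma continuantSS u0 u1 n : continuant u0 u1 n.+2 =
  (a n.+2 * continuant u0 u1 n.+1 + continuant u0 u1 n)%N.
Proof. by []. Qed.

Lemma cf_den_gt0 n : (0 < cf_den n)%N.
Proof.
suff: (0 < cf_den n)%N && (0 < cf_den n.+1)%N by case/andP.
elim: n => [|n /andP[h0 h1]]; first by rewrite /= a_gt0.
by rewrite h1 /cf_den continuantSS addn_gt0 h0 orbT.
Qed.

Lemma cf_den_leS n : (cf_den n <= cf_den n.+1)%N.
Proof.
case: n => [|n]; first by rewrite /= a_gt0.
rewrite /cf_den continuantSS -/cf_den.
by rewrite (leq_trans _ (leq_addr _ _)) // leq_pmull // a_gt0.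
Qed.

(** Strictness starts at index 1, because q_0 = q_1 when a_1 = 1. *)
Lemma cf_den_ltS n : (cf_den n.+1 < cf_den n.+2)%N.
Proof.
have := cf_den_gt0 n; have := a_gt0 (ltn0Sn n.+1).
rewrite {3}/cf_den continuantSS -/(cf_den _) -/(cf_den _); nia.
Qed.

Lemma cf_det n :
  (cf_num n.+1 * cf_den n)%:R - (cf_num n * cf_den n.+1)%:R = (-1) ^+ n :> int.
Proof.
elim: n => [|n ih]; first by rewrite /cf_num /cf_den /= mul0n muln1 subr0.
rewrite exprS -ih /cf_num /cf_den !continuantSS !(natrM, natrD); ring.
Qed.

(** The tail [y] is general because the last quotient sits innermost in the fold: the induction
    absorbs it into a new tail (a_(n+2) + y)^-1. The value is a Möbius transform of [y] whose matrix
    consists of two successive convergents. *)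
Lemma foldr_continuant n (y : R) : 0 <= y ->
  foldr (fun k z => ((a k)%:R + z)^-1) y (iota 1 n.+1) =
  ((cf_num n.+1)%:R + y * (cf_num n)%:R) / ((cf_den n.+1)%:R + y * (cf_den n)%:R).
Proof.
elim: n y => [|n ih] y y0.
  by rewrite /= mulr0 addr0 mulr1 mul1r.
have an : 0 < (a n.+2)%:R :> R by rewrite ltr0n a_gt0.
have qn : 0 < (cf_den n)%:R :> R by rewrite ltr0n cf_den_gt0.
have qn1 : 0 < (cf_den n.+1)%:R :> R by rewrite ltr0n cf_den_gt0.
rewrite -(addn1 n.+1) iotaD foldr_cat [foldr _ _ (iota (1 + n.+1) 1)]/= add1n ih;
  last first.
  by rewrite invr_ge0 addr_ge0 // ltW.
rewrite addn1 [cf_num n.+2]continuantSS [cf_den n.+2]continuantSS -/(cf_num _) -/(cf_den _).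
rewrite !(natrM, natrD).
by field; repeat (apply/andP; split); rewrite gt_eqF //; nra.
Qed.

Lemma cf_convergentE n :
  cf_convergent a n = (cf_num n)%:R / (cf_den n)%:R :> R.
Proof.
case: n => [|n]; first by rewrite /cf_convergent /= mul0r.
by rewrite /cf_convergent foldr_continuant // !mul0r !addr0.
Qed.

Lemma cf_den_ge n : (n <= cf_den n)%N.
Proof.
elim: n => // -[|n] ih; first by rewrite /= a_gt0.
exact: leq_ltn_trans ih (cf_den_ltS n).
Qed.

(** As a function of k, the determinant satisfies the recurrence of the convergents, with
    nonnegative coefficients; after the sign change its first two values are 0 and 1. Hence all
    later convergents lie on the same side of the n-th. *)
Lemma cf_det_sign n k :
  0 <= (-1) ^+ n * ((cf_num (n + k) * cf_den n)%:R
                    - (cf_num n * cf_den (n + k))%:R) :> int.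
Proof.
pose E k := (-1) ^+ n * ((cf_num (n + k) * cf_den n)%:R
                    - (cf_num n * cf_den (n + k))%:R) : int.
suff: (0 <= E k) && (0 <= E k.+1) by case/andP.
elim: k => [|k /andP[h0 h1]].
  by rewrite /E addn0 subrr mulr0 lexx addn1 cf_det -exprMn mulrNN mul1r expr1n.
rewrite h1 /=.
have -> : E k.+2 = (a (n + k).+2)%:R * E k.+1 + E k.
  rewrite /E !addnS /cf_num /cf_den !continuantSS !(natrM, natrD); ring.
by rewrite addr_ge0 // mulr_ge0.
Qed.

Lemma cf_det_signR n k :
  0 <= (-1) ^+ n * ((cf_num (n + k))%:R * (cf_den n)%:R
                    - (cf_num n)%:R * (cf_den (n + k))%:R) :> R.
Proof.
have := cf_det_sign n k.
by rewrite -(ler0z R) rmorphM rmorphXn rmorphB rmorphN rmorph1 /= !natrM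
  !rmorphM /= !natz -!pmulrn.
Qed.

Lemma cf_detR n :
  (cf_num n.+1)%:R * (cf_den n)%:R - (cf_num n)%:R * (cf_den n.+1)%:R
  = (-1) ^+ n :> R.
Proof.
have := congr1 (fun z : int => z%:~R : R) (cf_det n).
by rewrite rmorphXn rmorphB rmorphN rmorph1 /= !natrM
  !rmorphM /= !natz -!pmulrn.
Qed.

Let C n : R := cf_convergent a n.

Lemma cf_convergent_sign n k : 0 <= (-1) ^+ n * (C (n + k) - C n).
Proof.
have qn : 0 < (cf_den n)%:R :> R by rewrite ltr0n cf_den_gt0.
have qnk : 0 < (cf_den (n + k))%:R :> R by rewrite ltr0n cf_den_gt0.
rewrite /C !cf_convergentE.
have -> : (-1) ^+ n * ((cf_num (n + k))%:R / (cf_den (n + k))%:R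
   - (cf_num n)%:R / (cf_den n)%:R) = (-1) ^+ n * ((cf_num (n + k))%:R * (cf_den n)%:R
     - (cf_num n)%:R * (cf_den (n + k))%:R) / ((cf_den n)%:R * (cf_den (n + k))%:R) :> R.
  by field; rewrite !gt_eqF.
by rewrite divr_ge0 ?cf_det_signR // mulr_ge0 // ltW.
Qed.

Lemma cf_convergentS n :
  C n.+1 - C n = (-1) ^+ n / ((cf_den n)%:R * (cf_den n.+1)%:R).
Proof.
have qn : 0 < (cf_den n)%:R :> R by rewrite ltr0n cf_den_gt0.
have qn1 : 0 < (cf_den n.+1)%:R :> R by rewrite ltr0n cf_den_gt0.
by rewrite /C !cf_convergentE -cf_detR; field; rewrite !gt_eqF.
Qed.

(** For k > 0, the sign lemma at n and at n + 1 places C (n + k) between C n and C (n + 1), whose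
    distance is 1 / (q_n q_(n+1)). *)
Lemma cf_convergent_dist n k : `|C (n + k) - C n| <= n.+1%:R^-1.
Proof.
have [->|k0] := posnP k; first by rewrite addn0 subrr normr0 invr_ge0.
have h1 := cf_convergent_sign n k.
have h2 := cf_convergent_sign n.+1 k.-1.
have e : (n.+1 + k.-1 = n + k)%N by lia.
rewrite e exprS in h2.
have q1 : 1 <= (cf_den n)%:R :> R by rewrite ler1n cf_den_gt0.
have q2 : n.+1%:R <= (cf_den n.+1)%:R :> R by rewrite ler_nat cf_den_ge.
have h3 : (-1) ^+ n * (C n.+1 - C n) <= n.+1%:R^-1.
  rewrite cf_convergentS mulrA -exprMn mulrNN mul1r expr1n mul1r lef_pV2 ?posrE ?mulr_gt0 //.
  - by rewrite (le_trans q2) // ler_peMl.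
  - exact: lt_le_trans q1.
  - exact: lt_le_trans q2.
have <- : `|(-1) ^+ n * (C (n + k) - C n)| = `|C (n + k) - C n|.
  by rewrite normrM normrX normrN1 expr1n mul1r.
rewrite ger0_norm //.
rewrite mulN1r mulNr oppr_ge0 in h2.
apply: le_trans h3; rewrite -subr_ge0 -mulrBr opprB addrA subrK.
by rewrite -opprB mulrN oppr_ge0.
Qed.

Lemma cf_convergent_is_cvg : cvgn C.
Proof.
apply/cauchy_cvgP/cauchy_exP => e e0.
near \oo => n.
exists (C n); exists n => // m /= nm.
rewrite /ball /= distrC -(subnKC nm) (le_lt_trans (cf_convergent_dist _ _)) //.
near: n; exact: near_infty_natSinv_lt (PosNum e0).
Unshelve. all: by end_near. Qed.

Let x : R := cf_value a.

Lemma cvg_cf_convergent : C n @[n --> \oo] --> x.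
Proof. exact: cf_convergent_is_cvg. Qed.

Lemma cf_value_sign_ge0 n : 0 <= (-1) ^+ n * (x - C n).
Proof.
have h : (-1) ^+ n * (C m - C n) @[m --> \oo] --> (-1) ^+ n * (x - C n).
  by apply: cvgMr; apply: cvgB; [exact: cvg_cf_convergent|exact: cvg_cst].
rewrite -(cvg_lim _ h) //; apply: limr_ge; first by apply/cvg_ex; eexists; exact: h.
by exists n => // m /= nm; rewrite -(subnKC nm) cf_convergent_sign.
Qed.

(** The limit alone gives only a weak inequality. Strictness comes from the two jumps leading from C
    n to C (n + 2): they have opposite signs, and the first is larger since q_n < q_(n+2). *)
Lemma cf_value_sign_gt0 n : 0 < (-1) ^+ n * (x - C n).
Proof.
have q0 : 0 < (cf_den n)%:R :> R by rewrite ltr0n cf_den_gt0.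
have q1 : 0 < (cf_den n.+1)%:R :> R by rewrite ltr0n cf_den_gt0.
have q02 : (cf_den n)%:R < (cf_den n.+2)%:R :> R.
  by rewrite ltr_nat (leq_ltn_trans (cf_den_leS _) (cf_den_ltS _)).
have h := cf_value_sign_ge0 n.+2.
have h1 := cf_convergentS n.
have h2 := cf_convergentS n.+1.
have -> : x - C n = (x - C n.+2) + (C n.+2 - C n.+1) + (C n.+1 - C n) by ring.
rewrite h1 h2; move: h; rewrite !exprS !mulN1r opprK => h.
rewrite -addrA mulrDr ltr_wpDl // mulrDr mulNr mulrN !mulrA -exprMn mulrNN mul1r
  expr1n !mul1r addrC subr_gt0 ltf_pV2 ?posrE ?mulr_gt0 //; last exact: lt_trans q02.
by rewrite mulrC ltr_pM2l.
Qed.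

Definition cf_error n : R := `|(cf_den n)%:R * x - (cf_num n)%:R|.

(** Without the absolute value the error is linear in (q_n, p_n), so the recurrence and the
    determinant turn into exact identities between errors. *)
Lemma cf_errorE n :
  cf_error n = (-1) ^+ n * ((cf_den n)%:R * x - (cf_num n)%:R).
Proof.
have q0 : 0 < (cf_den n)%:R :> R by rewrite ltr0n cf_den_gt0.
have h : 0 < (-1) ^+ n * ((cf_den n)%:R * x - (cf_num n)%:R).
  have := mulr_gt0 q0 (cf_value_sign_gt0 n).
  rewrite /C cf_convergentE; congr (0 < _).
  by field; rewrite gt_eqF.
by rewrite -(gtr0_norm h) normrM normrX normrN1 expr1n mul1r.
Qed.

Lemma cf_error_gt0 n : 0 < cf_error n.
Proof.
have q0 : 0 < (cf_den n)%:R :> R by rewrite ltr0n cf_den_gt0.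
have := mulr_gt0 q0 (cf_value_sign_gt0 n).
rewrite cf_errorE /C cf_convergentE; congr (0 < _).
by field; rewrite gt_eqF.
Qed.

(** The terms in x cancel and the determinant remains. Both the upper and the lower bound for the
    error are read off from this identity. *)
Lemma cf_error_sum n :
  (cf_den n.+1)%:R * cf_error n + (cf_den n)%:R * cf_error n.+1 = 1.
Proof.
have h := cf_detR n; have e : (-1) ^+ n * (-1) ^+ n = 1 :> R.
  by rewrite -exprMn mulrNN mul1r expr1n.
rewrite !cf_errorE exprS -[RHS]e -[X in _ = _ * X]h; ring.
Qed.

Lemma cf_errorSS n :
  cf_error n = (a n.+2)%:R * cf_error n.+1 + cf_error n.+2.
Proof.
rewrite !cf_errorE !exprS /cf_num /cf_den !continuantSS !(natrM, natrD); ring.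
Qed.

Lemma cf_error_ltS n : cf_error n.+1 < cf_error n.
Proof.
rewrite [ltRHS]cf_errorSS; have := cf_error_gt0 n.+2; have := cf_error_gt0 n.+1.
have : 1 <= (a n.+2)%:R :> R by rewrite ler1n a_gt0.
nra.
Qed.

Lemma cf_error_lt n : cf_error n < (cf_den n.+1)%:R^-1.
Proof.
have q1 : 0 < (cf_den n.+1)%:R :> R by rewrite ltr0n cf_den_gt0.
have q0 : 0 < (cf_den n)%:R :> R by rewrite ltr0n cf_den_gt0.
rewrite -[ltRHS]mul1r ltr_pdivlMr // -[ltRHS](cf_error_sum n) mulrC ltrDl.
by rewrite mulr_gt0 // cf_error_gt0.
Qed.

Lemma cf_error_gt n : ((cf_den n.+1)%:R + (cf_den n)%:R)^-1 < cf_error n.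
Proof.
have q1 : 0 < (cf_den n.+1)%:R :> R by rewrite ltr0n cf_den_gt0.
have q0 : 0 < (cf_den n)%:R :> R by rewrite ltr0n cf_den_gt0.
rewrite -[ltLHS]mul1r ltr_pdivrMr ?addr_gt0 // -[ltLHS](cf_error_sum n) mulrDr.
rewrite ![cf_error n * _]mulrC.
by rewrite ltrD2l ltr_pM2l // cf_error_ltS.
Qed.

(* Expand (n, m) in the basis (q_k, p_k), (q_(k+1), p_(k+1)) of Z^2: since
   0 < n < q_(k+1), the two coordinates have opposite signs, and so the
   contributions of the two convergents to n x - m have the same sign. *)
Lemma cf_best_approx k n (m : int) : (0 < n < cf_den k.+1)%N ->
  cf_error k <= `|n%:R * x - m%:~R|.
Proof.
move=> /andP[n0 nq].
pose e : int := (-1) ^+ k.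
have ee : e * e = 1 by rewrite /e -exprMn mulrNN mul1r expr1n.
have det := cf_det k; rewrite -/e !natrM in det.
set q := cf_den k in det *; set q' := cf_den k.+1 in det nq *.
set p := cf_num k in det *; set p' := cf_num k.+1 in det *.
(* Cramer's rule; the determinant [e] is its own inverse, so the coordinates are integers. *)
pose u : int := e * (n%:R * p'%:R - m * q'%:R).
pose v : int := e * (m * q%:R - n%:R * p%:R).
have hn : n%:R = u * q%:R + v * q'%:R :> int.
  have -> : n%:R = n%:R * (e * e) :> int by rewrite ee mulr1.
  by rewrite -{2}det /u /v; ring.
have hm : m = u * p%:R + v * p'%:R.
  have -> : m = m * (e * e) :> int by rewrite ee mulr1.
  by rewrite -{2}det /u /v; ring.
have hx : `|n%:R * x - m%:~R| = `|u%:~R * cf_error k - v%:~R * cf_error k.+1|.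
  have -> : u%:~R * cf_error k - v%:~R * cf_error k.+1
      = (-1) ^+ k * (n%:R * x - m%:~R).
    have -> : n%:R = u%:~R * q%:R + v%:~R * q'%:R :> R.
      by have := congr1 (fun z : int => z%:~R : R) hn;
        rewrite rmorphD !rmorphM /= !natz -!pmulrn.
    have -> : m%:~R = u%:~R * p%:R + v%:~R * p'%:R :> R.
      by have := congr1 (fun z : int => z%:~R : R) hm;
        rewrite rmorphD !rmorphM /= !natz -!pmulrn.
    by rewrite !cf_errorE exprS; ring.
  by rewrite normrM normrX normrN1 expr1n mul1r.
have q0 : (0 < q)%N by exact: cf_den_gt0.
have e0 := cf_error_gt0 k; have e1 := cf_error_gt0 k.+1.
rewrite {}hx; rewrite !natz in hn.
have [v0|v0|v0] := ltgtP v 0.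
- have u1 : 1 <= u by nia.
  have u1' : 1 <= u%:~R :> R by rewrite ler1z.
  have v1' : v%:~R <= 0 :> R by rewrite lerz0 ltW.
  by rewrite (le_trans _ (ler_norm _)) //; nra.
- have u1 : u <= -1 by nia.
  have u1' : u%:~R <= -1 :> R by rewrite -[-1]/((-1)%:~R) ler_int.
  have v1' : 0 <= v%:~R :> R by rewrite ler0z ltW.
  by rewrite -normrN (le_trans _ (ler_norm _)) //; nra.
- have u0 : u != 0 by apply/eqP => u0; move: hn n0; rewrite u0 v0; lia.
  rewrite v0 mul0r subr0 normrM (gtr0_norm e0) ler_peMl ?(ltW e0) //.
  by rewrite -intr_norm ler1z; lia.
Qed.

Lemma dist_int_le (y : R) (m : int) : dist_int y <= `|y - m%:~R|.
Proof. by have [m' [-> h]] := dist_int_min y. Qed.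

Lemma cf_error_le_dist_int k n : (0 < n < cf_den k.+1)%N ->
  cf_error k <= dist_int (n%:R * x).
Proof.
by move=> h; have [m [-> _]] := dist_int_min (n%:R * x); exact: cf_best_approx.
Qed.

(** If x had denominator b, then b < q_(b+1), so best approximation at k = b would bound the
    positive error of the b-th convergent by |b x - p| = 0. *)
Lemma irrational_cf_value : irrational x.
Proof.
move=> [p _ px].
have dp : (0 < `|denq p|)%N by rewrite absz_gt0 denq_neq0.
have := @cf_best_approx `|denq p| `|denq p| (numq p).
rewrite dp (cf_den_ge `|denq p|.+1).
have -> : (`|denq p|)%:R = (denq p)%:~R :> R.
  by rewrite pmulrn gez0_abs // ltW // denq_gt0.
have d0 : (denq p)%:~R != 0 :> R by rewrite intr_eq0 denq_neq0.
rewrite -px /ratr mulrC divfK // subrr normr0.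
by move=> /(_ isT); rewrite leNgt cf_error_gt0.
Qed.

Hypothesis a1_gt1 : (1 < a 1)%N.

Lemma cf_den_lt n : (cf_den n < cf_den n.+1)%N.
Proof. by case: n => [|n]; [rewrite /= a1_gt1|exact: cf_den_ltS]. Qed.

(** Best approximation applies to n = q_k only if q_k < q_(k+1), which for k = 0 means a_1 > 1: with
    a_1 = 1 one has x > 1/2, and p_0 = 0 is not the integer nearest to x. *)
Lemma dist_int_cf_den k : dist_int ((cf_den k)%:R * x) = cf_error k.
Proof.
apply/eqP; rewrite eq_le cf_error_le_dist_int ?cf_den_gt0 ?cf_den_lt //.
by rewrite andbT (le_trans (dist_int_le _ (cf_num k))).
Qed.

End Convergents.

(** * Distance to the nearest integer and power sums *)

Section SineDistance.
Context {R : realType}.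
Implicit Types x y z : R.

Lemma sin_mean_value y : 0 <= y -> exists2 c, 0 <= c <= y & sin y = cos c * y.
Proof.
move=> y0; have [c cy h] := @MVT_segment R sin cos 0 y y0
  (fun z _ => is_derive_sin z) (continuous_subspaceT (@continuous_sin R)).
by exists c; [move: cy; rewrite in_itv|rewrite -[LHS]subr0 -sin0 h subr0].
Qed.

Lemma sin_le y : 0 <= y -> sin y <= y.
Proof.
move=> y0; have [c _ ->] := sin_mean_value y0.
by rewrite ler_piMl // cos_le1.
Qed.

Lemma sin_ge_cos y : 0 <= y <= pi -> y * cos y <= sin y.
Proof.
move=> /andP[y0 ypi]; have [c /andP[c0 cy] ->] := sin_mean_value y0.
rewrite mulrC ler_wpM2r //; have [->//|cny] := eqVneq c y.
apply: ltW; rewrite ltr_cos ?in_itv /= ?lt_neqAle ?cny ?cy ?y0 ?c0 //.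
exact: le_trans ypi.
Qed.

(* By the mean value theorem on both sides of pi z, a value below the chord
   would force cos to be larger to the right of pi z than to the left. *)
Lemma sin_ge_chord z : 0 <= z <= 2^-1 -> 2 * z <= sin (pi * z).
Proof.
move=> /andP[z0 z2]; have pi0 := pi_gt0 R; rewrite leNgt; apply/negP => lt_s.
have pz0 : 0 <= pi * z by rewrite mulr_ge0 // ltW.
have pz2 : pi * z <= pi / 2 by rewrite ler_pM2l.
have [c /andP[c0 cz] hc] := sin_mean_value pz0.
have [e ez he] := @MVT_segment R sin cos (pi * z) (pi / 2) pz2
  (fun z _ => is_derive_sin z) (continuous_subspaceT (@continuous_sin R)).
move: ez; rewrite in_itv /= => /andP[ze e2].
have cec : cos e <= cos c.
  have [->//|ne] := eqVneq c e.
  apply: ltW; rewrite ltr_cos ?in_itv /= ?lt_neqAle ?ne ?(le_trans cz ze) //.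
    by rewrite c0 (le_trans cz) // (le_trans pz2) // ler_piMr ?(ltW pi0) // invf_le1 // ler1n.
  by rewrite (le_trans pz0 ze) (le_trans e2) // ler_piMr ?(ltW pi0) // invf_le1 // ler1n.
rewrite sin_pihalf in he; rewrite hc in he lt_s.
have z_gt0 : 0 < z.
  by rewrite lt_neqAle z0 andbT; apply: contraTneq lt_s => <-; rewrite !mulr0 ltxx.
have c2 : cos c * pi < 2 by rewrite -(ltr_pM2r z_gt0) -mulrA.
have := ler_wpM2r (ltW pi0) cec; nra.
Qed.

Lemma sin_pi_int (m : int) : sin (pi * m%:~R) = 0 :> R.
Proof.
have nat0 n : sin (pi * n%:R) = 0 :> R.
  elim: n => [|n ih]; first by rewrite mulr0 sin0.
  by rewrite -natr1 mulrDr mulr1 sinD ih sinpi mul0r mulr0 addr0.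
case: m => n; first by rewrite -pmulrn nat0.
rewrite NegzE rmorphN /= mulrN sinN.
by have := nat0 n.+1; rewrite pmulrn => ->; rewrite oppr0.
Qed.

Lemma norm_sinD_pi_int y (m : int) : `|sin (y + pi * m%:~R)| = `|sin y|.
Proof.
by rewrite sinD sin_pi_int mulr0 addr0 normrM (sin0cos1 (sin_pi_int m)) mulr1.
Qed.

Lemma dist_int_ge0 y : 0 <= dist_int y.
Proof. by have [m [-> _]] := dist_int_min y. Qed.

Lemma dist_int_le_half y : dist_int y <= 2^-1.
Proof.
have h1 := dist_int_le y (Num.floor y); have h2 := dist_int_le y (Num.floor y + 1).
have /andP[f1 f2] := floor_itv y.
rewrite ger0_norm ?subr_ge0 // in h1; rewrite ler0_norm ?subr_le0 ?(ltW f2) // in h2.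
rewrite intrD mulr1z in f2 h2; lra.
Qed.

Lemma dist_intD y z : dist_int (y + z) <= dist_int y + dist_int z.
Proof.
have [m [-> _]] := dist_int_min y; have [n [-> _]] := dist_int_min z.
rewrite (le_trans (dist_int_le _ (m + n))) // (le_trans _ (ler_normD _ _)) //.
by rewrite intrD opprD addrACA.
Qed.

Lemma dist_intN y : dist_int (- y) = dist_int y.
Proof.
suff le z : dist_int (- z) <= dist_int z.
  by apply/eqP; rewrite eq_le le -{1}(opprK y) le.
have [m [-> _]] := dist_int_min z.
rewrite (le_trans (dist_int_le _ (- m))) //.
by rewrite rmorphN opprK -normrN opprD !opprK.
Qed.

Lemma norm_sin_dist_int y : `|sin (pi * y)| = sin (pi * dist_int y).
Proof.
have := dist_int_ge0 y; have := dist_int_le_half y.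
have [m [-> _]] := dist_int_min y => h2 h0.
rewrite -{1}(subrK m%:~R y) mulrDr norm_sinD_pi_int.
have pi0 := pi_gt0 R.
rewrite -[RHS]ger0_norm; last first.
  apply: sin_ge0_pi; rewrite mulr_ge0 ?(ltW pi0) //= ler_piMr ?(ltW pi0) //.
  by rewrite (le_trans h2) // invf_le1 // ler1n.
by have [_|_] := ger0P (y - m%:~R); rewrite // mulrN sinN normrN.
Qed.

Lemma norm_sin_ge y : 2 * dist_int y <= `|sin (pi * y)|.
Proof. by rewrite norm_sin_dist_int sin_ge_chord // dist_int_ge0 dist_int_le_half. Qed.

Lemma norm_sin_le y : `|sin (pi * y)| <= pi * dist_int y.
Proof.
by rewrite norm_sin_dist_int sin_le // mulr_ge0 ?dist_int_ge0 // ltW // pi_gt0.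
Qed.

Lemma norm_sin_ge_cos y : pi * dist_int y * cos (pi * dist_int y) <= `|sin (pi * y)|.
Proof.
rewrite norm_sin_dist_int sin_ge_cos // mulr_ge0 ?dist_int_ge0 ?(ltW (pi_gt0 R)) //=.
rewrite ler_piMr ?(ltW (pi_gt0 R)) // (le_trans (dist_int_le_half y)) //.
by rewrite invf_le1 // ler1n.
Qed.

End SineDistance.

Section PowerSums.
Context {R : realType}.
Implicit Types (t d y : R).

Lemma ler_powRN t x y : 0 <= t -> 0 < x -> x <= y -> y `^ (- t) <= x `^ (- t).
Proof.
move=> t0 x0 xy; have y0 := lt_le_trans x0 xy.
by rewrite !powRN lef_pV2 ?posrE ?powR_gt0 // ge0_ler_powR // nnegrE ltW.
Qed.

Lemma powR_ge1 y t : 1 <= y -> 0 <= t -> 1 <= y `^ t.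
Proof. by move=> y1 t0; rewrite -(powRr0 y) ler_powR. Qed.

(** A discrete form of the integral of (t - 1) y^(-t). With z = n + 2 and p = t - 1, division by
    z^(-p) leaves 1 + p / z <= (1 - 1 / z)^(-p), which follows from 1 + v <= exp v and ln (1 - 1 /
    z) <= - 1 / z. *)
Lemma powR_neg_telescope t (n : nat) : 1 < t ->
  (t - 1) * n.+2%:R `^ (- t) <= n.+1%:R `^ (1 - t) - n.+2%:R `^ (1 - t) :> R.
Proof.
move=> t1; set z : R := n.+2%:R; set p := t - 1.
have p0 : 0 < p by rewrite subr_gt0.
have z0 : 0 < z by rewrite ltr0n.
have zn : n.+1%:R = z * (1 - z^-1) :> R.
  by rewrite mulrBr mulr1 divff ?gt_eqF // /z -(natr1 n.+1) addrK.
have h0 : 0 < 1 - z^-1 by rewrite subr_gt0 invf_lt1 // ltr1n.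
have -> : 1 - t = - p by rewrite /p; ring.
have -> : - t = - p + -1 by rewrite /p; ring.
rewrite zn powRM ?(ltW z0) ?(ltW h0) // powRD; last by rewrite (gt_eqF z0) implybT.
rewrite powR_inv1 ?(ltW z0) //.
have h1 : 1 + p * z^-1 <= (1 - z^-1) `^ (- p).
  rewrite /powR gt_eqF // (le_trans _ (expR_ge1Dx _)) // lerD2l mulNr -mulrN.
  rewrite ler_pM2l // lerNr le_ln1Dx // ltrNl opprK invf_lt1 //; rewrite ltr1n //.
rewrite lerBrDl (le_trans _ (ler_wpM2l (powR_ge0 z (- p)) h1)) //.
by rewrite mulrDr mulr1 lerD2l mulrCA.
Qed.

(** The constant is 1 + 1 / (t - 1): the term n = 1, and a telescoping rest. It serves with exponent
    t inside a block and with exponent r over the blocks. *)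
Lemma sum_powRN_le t (N : nat) : 1 < t ->
  \sum_(1 <= n < N) n%:R `^ (- t) <= t / (t - 1) :> R.
Proof.
move=> t1; have p0 : 0 < t - 1 by rewrite subr_gt0.
have main n : (t - 1) * \sum_(1 <= i < n.+2) i%:R `^ (- t) <= t - n.+1%:R `^ (1 - t) :> R.
  elim: n => [|n ih]; first by rewrite big_nat1 !powR1 mulr1.
  rewrite big_nat_recr //= mulrDr; have := powR_neg_telescope n t1; lra.
have le0 : 0 <= t / (t - 1) by rewrite divr_ge0 // ltW // (lt_trans ltr01).
case: N => [|[|n]]; try by rewrite big_geq.
rewrite ler_pdivlMr // mulrC (le_trans (main n)) // gerBl powR_ge0 //.
Qed.

Lemma ler_sum_uniq (F : nat -> R) (s : seq nat) (N : nat) :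
  uniq s -> (forall n, n \in s -> (0 < n < N)%N) -> (forall n, 0 <= F n) ->
  \sum_(n <- s) F n <= \sum_(1 <= n < N) F n.
Proof.
move=> us sN F0; rewrite [leRHS](bigID (mem s)) /= -(big_filter _ (mem s)).
rewrite [X in _ <= X + _](perm_big s) ?lerDl ?sumr_ge0 //=.
apply: uniq_perm => [||n]; rewrite ?filter_uniq ?iota_uniq //.
rewrite mem_filter mem_index_iota; apply/idP/idP => [/andP[]//|ns].
by apply/andP; split=> //; exact: sN.
Qed.

Section SeparatedPoints.
Variables (t d B : R).
Hypotheses (t_ge0 : 0 <= t) (d_gt0 : 0 < d).
Hypothesis sumB : forall N : nat, \sum_(1 <= n < N) n%:R `^ (- t) <= B.

Let separated (y : nat -> R) (I : seq nat) : Prop :=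
  forall m n, m \in I -> n \in I -> m != n -> d <= `|y m - y n|.

(* The integer parts of y n / d are positive and pairwise distinct. *)
Lemma sum_powRN_separated_pos (y : nat -> R) (I : seq nat) : uniq I -> separated y I ->
  (forall n, n \in I -> d <= y n) ->
  \sum_(n <- I) y n `^ (- t) <= d `^ (- t) * B.
Proof.
move=> uI sep dy; pose z n := Num.truncn (y n / d).
have zitv n : n \in I -> d * (z n)%:R <= y n < d * (z n)%:R + d.
  move=> nI; have yd : 0 <= y n / d by rewrite divr_ge0 ?(ltW d_gt0) // (le_trans (ltW d_gt0)) ?dy.
  have := Num.Theory.truncn_itv yd; rewrite -/(z n) -natr1.
  by rewrite ler_pdivlMr // ltr_pdivrMr // mulrDl mul1r ![_ * d]mulrC.
have z_gt0 n : n \in I -> (0 < z n)%N.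
  by move=> nI; rewrite /z truncn_gt0 ler_pdivlMr // mul1r dy.
have zinj : {in I &, injective z}.
  move=> m n mI nI zmn; apply: contraTeq isT => mn.
  have := sep _ _ mI nI mn; have := zitv _ mI; have := zitv _ nI; rewrite zmn.
  move=> /andP[a1 a2] /andP[b1 b2]; rewrite leNgt ltr_norml.
  have -> : - d < y m - y n by lra.
  by have -> : y m - y n < d by lra.
have uz : uniq (map z I) by rewrite map_inj_in_uniq.
pose N := (\max_(n <- map z I) n).+1.
rewrite (@le_trans _ _ (\sum_(n <- I) d `^ (- t) * (z n)%:R `^ (- t))) //.
  rewrite big_seq [leRHS]big_seq ler_sum // => n nI.
  rewrite -powRM ?(ltW d_gt0) // ler_powRN //; last by case/andP: (zitv _ nI).
  by rewrite mulr_gt0 // ltr0n z_gt0.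
rewrite -mulr_sumr ler_wpM2l ?powR_ge0 //.
rewrite -(big_map z predT (fun n : nat => n%:R `^ (- t))) (le_trans _ (sumB N)) //.
apply: ler_sum_uniq => // n nz.
rewrite ltnS (@leq_bigmax_seq _ _ predT id n nz) // andbT.
by move/mapP: nz => [m mI ->]; exact: z_gt0.
Qed.

(** The positive points and the reflected negative points are treated separately, whence the factor
    2. *)
Lemma sum_powRN_separated (y : nat -> R) (I : seq nat) : uniq I -> separated y I ->
  (forall n, n \in I -> d <= `|y n|) ->
  \sum_(n <- I) `|y n| `^ (- t) <= 2 * (d `^ (- t) * B).
Proof.
move=> uI sep dy; rewrite (bigID (fun n => 0 < y n)) /= mulr2n mulrDl !mul1r.
rewrite -!(big_filter I) lerD //.
- rewrite big_seq (eq_bigr (fun n => y n `^ (- t))) => [|n]; last first.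
    by rewrite mem_filter => /andP[y0 _]; rewrite gtr0_norm.
  rewrite -big_seq; apply: sum_powRN_separated_pos; first by rewrite filter_uniq.
    by move=> m n; rewrite !mem_filter => /andP[_ mI] /andP[_ nI]; exact: sep.
  by move=> n; rewrite mem_filter => /andP[y0 nI]; rewrite -(gtr0_norm y0) dy.
- rewrite big_seq (eq_bigr (fun n => (- y n) `^ (- t))) => [|n]; last first.
    by rewrite mem_filter -leNgt => /andP[y0 _]; rewrite ler0_norm.
  rewrite -big_seq; apply: (@sum_powRN_separated_pos (fun n => - y n)).
  + by rewrite filter_uniq.
  + move=> m n; rewrite !mem_filter => /andP[_ mI] /andP[_ nI] mn.
    by rewrite -opprD normrN; exact: sep.
  + by move=> n; rewrite mem_filter -leNgt => /andP[y0 nI]; rewrite -(ler0_norm y0) dy.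
Qed.

End SeparatedPoints.

End PowerSums.

(** * The sum of the terms over one block *)

Section Blocks.
Context {R : realType}.
Variable a : nat -> nat.
Hypothesis a_gt0 : forall k, (0 < k)%N -> (0 < a k)%N.
Let q := cf_den a.
Let x : R := cf_value a.

(* Two indices below q_(k+1) differ by less than q_(k+1), so the multiples n x
   are separated modulo 1 by the error of the k-th convergent. *)
Lemma summand_block_le (s t B : R) k : 0 <= s -> 0 <= t ->
  (forall N : nat, \sum_(1 <= n < N) n%:R `^ (- t) <= B) ->
  \sum_(q k <= n < q k.+1) summand s t x n
    <= 2 * B * (((q k.+1)%:R + (q k)%:R) `^ t / (q k)%:R `^ s).
Proof.
move=> s0 t0 sumB.
(* [m n] is an integer nearest to n x, so that |y n| is the distance of n x to the integers. *)
have [m mE] := choice (fun n =>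
  let: ex_intro i (conj h _) := dist_int_min (n%:R * x) in ex_intro _ i h).
pose y n := n%:R * x - (m n)%:~R.
have q0 j : (0 < q j)%N by exact: cf_den_gt0.
have Q0 j : 0 < (q j)%:R :> R by rewrite ltr0n.
have e0 := cf_error_gt0 (R := R) a_gt0 k.
have B0 : 0 <= B by have := sumB 0%N; rewrite big_geq.
have posI n : n \in index_iota (q k) (q k.+1) -> (0 < n < q k.+1)%N.
  by rewrite mem_index_iota => /andP[h ->]; rewrite (leq_trans (q0 k)).
have dy n : n \in index_iota (q k) (q k.+1) -> cf_error a k <= `|y n|.
  by move=> /posI nI; exact: cf_best_approx.
rewrite (@le_trans _ _ (\sum_(n <- index_iota (q k) (q k.+1))
    (q k)%:R `^ (- s) * `|y n| `^ (- t))) //.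
  rewrite big_seq [leRHS]big_seq ler_sum // => n nI.
  have yn := lt_le_trans e0 (dy _ nI).
  rewrite /summand ler_pM ?powR_ge0 ?ler_powRN //.
    by move: nI; rewrite mem_index_iota ler_nat => /andP[].
  have := norm_sin_ge (n%:R * x); rewrite mE mulrA -/(y n); lra.
rewrite -mulr_sumr powRN [leRHS]mulrA [leRHS]mulrC ler_pM2l ?invr_gt0 ?powR_gt0 //.
rewrite (le_trans (sum_powRN_separated t0 e0 sumB _ _ dy)) ?iota_uniq //.
  move=> i j /posI iI /posI jI; wlog lt_ij : i j iI jI / (i < j)%N.
    move=> hw ij; have [lt|lt] := leqP i j.
      by apply: hw => //; rewrite ltn_neqAle ij.
    by rewrite distrC; apply: hw => //; rewrite eq_sym.
  move=> _; rewrite distrC.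
  have -> : y j - y i = (j - i)%:R * x - (m j - m i)%:~R.
    by rewrite natrB ?(ltnW lt_ij) // rmorphB /y /=; ring.
  apply: cf_best_approx => //; rewrite subn_gt0 lt_ij (leq_ltn_trans (leq_subr _ _)) //.
  by case/andP: jI.
rewrite -mulrA ler_pM2l // mulrC ler_wpM2l //.
have s0' : 0 < (q k.+1)%:R + (q k)%:R :> R by rewrite addr_gt0.
rewrite (le_trans (ler_powRN t0 _ (ltW (cf_error_gt a_gt0 k)))) ?invr_gt0 //.
by rewrite -(powR_inv1 (ltW s0')) -powRrM mulN1r opprK.
Qed.

End Blocks.

(** * Growth of the denominators *)

Lemma cvg_powR_seq (R : realType) (u : R^nat) (l p : R) : 0 < l ->
  u @ \oo --> l -> u n `^ p @[n --> \oo] --> l `^ p.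
Proof.
move=> l0 ul; suff c : {for l, continuous (fun z : R => z `^ p)}.
  exact: (continuous_cvg _ c ul).
apply: differentiable_continuous; apply/derivable1_diffP.
by have [] := is_derive1_powR p l0.
Qed.

Section Growth.
Context {R : realType}.
Variables (t beta r : R).
Hypotheses (t_gt1 : 1 < t) (beta_gt1 : 1 < beta) (r_ge0 : 0 <= r).

Let t_gt0 : 0 < t. Proof. exact: lt_trans t_gt1. Qed.
Let s := t * beta.
Let a := partial_quotient t beta r.
Let q := denominator t beta r.

Lemma denominator_gt0 k : (0 < q k)%N.
Proof.
suff: (0 < q k)%N && (0 < q k.+1)%N by case/andP.
elim: k => [//|k /andP[h0 h1]].
by rewrite h1 /q denominatorSS addn_gt0 h0 orbT.
Qed.

Let q_gt0 k : 0 < (q k)%:R :> R.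
Proof. by rewrite ltr0n denominator_gt0. Qed.

(** The quotient a_(k+1) before rounding up. At k = 0 the formula gives 1 while a_1 = 2, so the
    estimates comparing the two assume 0 < k. *)
Definition raw_quotient k : R := (q k)%:R `^ (beta - 1) / k.+1%:R `^ (r / t).

Let A := raw_quotient.

Lemma raw_quotient_gt0 k : 0 < A k.
Proof. by rewrite divr_gt0 // powR_gt0 // ltr0n. Qed.

Let ceilA k : (0 < k)%N -> (a k.+1)%:R = (Num.ceil (A k))%:~R :> R.
Proof. by move=> k0; rewrite -(partial_quotientS t beta r k0). Qed.

Lemma raw_quotient_itv k : (0 < k)%N -> A k <= (a k.+1)%:R < A k + 1.
Proof.
move=> k0; rewrite ceilA // ceil_ge /=.
by have := ceilB1_lt (A k); rewrite intrD; rewrite ltrBlDr.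
Qed.

Lemma partial_quotient_gt0 k : (0 < k)%N -> (0 < a k)%N.
Proof.
case: k => [//|[|k]] _; first by [].
rewrite -(ltr0n R) (lt_le_trans (raw_quotient_gt0 k.+1)) //.
by have /andP[] := raw_quotient_itv (ltn0Sn k).
Qed.

Lemma denominatorE : q = cf_den a.
Proof.
apply/funext => k; suff: q k = cf_den a k /\ q k.+1 = cf_den a k.+1 by case.
elim: k => [//|k [h0 h1]]; split=> //.
by rewrite /cf_den continuantSS -/(cf_den a) -h0 -h1 -denominatorSS.
Qed.

Lemma denominator_recE k : (0 < k)%N ->
  (q k.+1)%:R = (a k.+1)%:R * (q k)%:R + (q k.-1)%:R :> R.
Proof. by case: k => // k _; rewrite /q denominatorSS natrD natrM. Qed.

Lemma denominator_ltS k : (q k < q k.+1)%N.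
Proof. by rewrite denominatorE cf_den_lt //; exact: partial_quotient_gt0. Qed.

Lemma denominator_ge k : (k < q k)%N.
Proof. by elim: k => // k ih; exact: leq_ltn_trans ih (denominator_ltS k). Qed.

(** From q_(k+2) >= 2 q_k the growth rate is at least the square root of 2; squaring keeps the
    statement in the natural numbers. *)
Lemma denominator_sqr_ge k : (2 ^ k <= q k ^ 2)%N.
Proof.
suff: (2 ^ k <= q k ^ 2)%N && (2 ^ k.+1 <= q k.+1 ^ 2)%N by case/andP.
elim: k => [//|k /andP[h0 h1]]; rewrite h1 /=.
have h : (2 * q k <= q k.+2)%N.
  have := partial_quotient_gt0 (ltn0Sn k.+1); have := denominator_ltS k.
  rewrite /q denominatorSS -/q -/a -/(q _); nia.
by rewrite !expnS in h0 h1 *; nia.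
Qed.

Lemma ln_denominator_ge k : k%:R * (ln 2 / 2) <= ln (q k)%:R :> R.
Proof.
have h : 2%:R ^+ k <= (q k)%:R ^+ 2 :> R.
  by rewrite -!natrX ler_nat denominator_sqr_ge.
have : ln (2%:R ^+ k) <= ln ((q k)%:R ^+ 2) :> R.
  by rewrite ler_ln ?posrE ?exprn_gt0.
rewrite !lnXn // -(mulr_natl (ln 2)) -(mulr_natl (ln (q k)%:R)); lra.
Qed.

Lemma ln_denominator_gt0 k : (0 < k)%N -> 0 < ln (q k)%:R :> R.
Proof.
by move=> k0; rewrite ln_gt0 // ltr1n (leq_ltn_trans k0) // denominator_ge.
Qed.

(* ln y <= e y - 1 - ln e, with a multiple e of delta small enough. *)
Lemma ln_denominator_dominates (delta rho M : R) : 0 < delta -> 0 <= rho ->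
  \forall k \near \oo, M <= delta * ln (q k)%:R - rho * ln k.+1%:R.
Proof.
move=> d0 rho0; have l2 : 0 < ln 2 :> R by rewrite ln_gt0 // ltr1n.
(* This makes rho e at most delta ln 2 / 4, half of the slope guaranteed by [ln_denominator_ge]; rho
   + 1 allows rho = 0. The remaining slope delta ln 2 / 4 determines the threshold for k in [hk]. *)
pose e := delta * ln 2 / (4 * (rho + 1)).
have rho1 : 0 < 4 * (rho + 1) by lra.
have e0 : 0 < e by rewrite divr_gt0 // mulr_gt0.
have re : rho * e <= delta * ln 2 / 4.
  have : e * (4 * (rho + 1)) = delta * ln 2 by rewrite divfK // gt_eqF.
  lra.
have lnle k : ln k.+1%:R <= e * k.+1%:R - 1 - ln e.
  have := @le_ln1Dx R (e * k.+1%:R - 1).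
  rewrite [1 + _]addrC subrK lnM ?posrE // => h; rewrite lerBrDl; apply: h.
  by rewrite ltrBrDl subrr mulr_gt0.
near=> k.
have h1 := ler_wpM2l (ltW d0) (ln_denominator_ge k).
have h2 := ler_wpM2l rho0 (lnle k).
have hk : 4 / (delta * ln 2) * (M + delta * ln 2 / 4 + rho * (- 1 - ln e)) <= k%:R.
  by near: k; exact: nbhs_infty_ger.
have dl : 0 < delta * ln 2 by rewrite mulr_gt0.
rewrite mulrAC ler_pdivrMr // in hk.
have h3 : rho * (e * k.+1%:R) <= delta * ln 2 / 4 * (k%:R + 1).
  by rewrite mulrA natr1 ler_wpM2r.
lra.
Unshelve. all: by end_near. Qed.

Lemma powR_denominator_dominates (delta rho : R) : 0 < delta -> 0 <= rho ->
  (q k)%:R `^ delta / k.+1%:R `^ rho @[k --> \oo] --> +oo.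
Proof.
move=> d0 rho0; apply/cvgryPge => M; near=> k.
rewrite -[leRHS]lnK ?posrE ?divr_gt0 ?powR_gt0 //.
rewrite ln_div ?posrE ?powR_gt0 // !ln_powR.
rewrite (le_trans _ (expR_ge1Dx _)) // -lerBlDl.
by near: k; exact: ln_denominator_dominates.
Unshelve. all: by end_near. Qed.

Lemma raw_quotient_cvgy : A k @[k --> \oo] --> +oo.
Proof.
apply: powR_denominator_dominates; first by rewrite subr_gt0.
by rewrite divr_ge0 // ltW.
Qed.

Lemma raw_quotientV_cvg0 : (A k)^-1 @[k --> \oo] --> (0 : R).
Proof.
apply/gtr0_cvgV0; last exact: raw_quotient_cvgy.
by apply: nearW => k; exact: raw_quotient_gt0.
Qed.

Lemma ln_denominator_cvgy : ln (q k)%:R @[k --> \oo] --> (+oo : set_system R).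
Proof.
apply/cvgryPge => M; near=> k.
have -> : ln (q k)%:R = 1 * ln (q k)%:R - 0 * ln k.+1%:R :> R by rewrite mul1r mul0r subr0.
by near: k; exact: ln_denominator_dominates.
Unshelve. all: by end_near. Qed.

Lemma ln_denominatorV_cvg0 : (ln (q k)%:R)^-1 @[k --> \oo] --> (0 : R).
Proof.
apply/gtr0_cvgV0; last exact: ln_denominator_cvgy.
by exists 1%N => // k k0; exact: ln_denominator_gt0.
Qed.

Lemma ln_ratio_cvg0 : ln k.+1%:R / ln (q k)%:R @[k --> \oo] --> (0 : R).
Proof.
apply/cvgrPdist_le => e e0; near=> k.
have k0 : (0 < k)%N by near: k; exact: nbhs_infty_gt.
rewrite sub0r normrN ger0_norm ?divr_ge0 ?ln_ge0 ?ler1n //; last exact: denominator_gt0.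
rewrite ler_pdivrMr ?ln_denominator_gt0 // -subr_ge0 -[X in _ - X]mul1r.
by near: k; exact: ln_denominator_dominates.
Unshelve. all: by end_near. Qed.

(** The relative effect of the rounding and of the summand q_(k-1) in the recurrence. *)
Definition growth_defect k : R := (q k.+1)%:R / ((q k)%:R * A k).

Let W := growth_defect.

Lemma denominatorM_raw k : (q k)%:R * A k = (q k)%:R `^ beta / k.+1%:R `^ (r / t).
Proof. by rewrite mulrA mulr_powRB1 // ?ltW // (lt_trans ltr01). Qed.

Let qA_gt0 k : 0 < (q k)%:R * A k.
Proof. by rewrite mulr_gt0 // raw_quotient_gt0. Qed.

Lemma growth_defect_gt0 k : 0 < W k.
Proof. by rewrite divr_gt0. Qed.

(** Rounding up adds at most q_k to q_k A_k, and q_(k-1) adds at most another q_k. *)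
Lemma growth_defect_itv k : (0 < k)%N -> 1 <= W k <= 1 + 2 * (A k)^-1.
Proof.
move=> k0; have /andP[h1 h2] := raw_quotient_itv k0.
have A0 := raw_quotient_gt0 k.
have le_q : (q k.-1)%:R <= (q k)%:R :> R.
  by rewrite ler_nat -{2}(prednK k0) ltnW // denominator_ltS.
rewrite ler_pdivlMr // ler_pdivrMr // mul1r denominator_recE //.
have -> : (1 + 2 / A k) * ((q k)%:R * A k) = (A k + 2) * (q k)%:R.
  by field; rewrite gt_eqF.
have := q_gt0 k; have := q_gt0 k.-1; move=> p1 p2; apply/andP; split; nra.
Qed.

Lemma growth_defect_cvg1 : W k @[k --> \oo] --> (1 : R).
Proof.
apply: (@squeeze_cvgr _ _ _ _ (cst 1) (fun k => 1 + 2 * (A k)^-1)).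
- by exists 1%N => // k k0; exact: growth_defect_itv.
- exact: cvg_cst.
- rewrite -[X in _ --> X]addr0 -[X in _ + X](mulr0 2).
  by apply: cvgD; [exact: cvg_cst|apply: cvgMr; exact: raw_quotientV_cvg0].
Qed.

Lemma growth_ratioE k :
  (q k.+1)%:R `^ t / (q k)%:R `^ s = W k `^ t * k.+1%:R `^ (- r).
Proof.
have -> : (q k.+1)%:R = W k * ((q k)%:R * A k) by rewrite divfK // gt_eqF.
rewrite powRM ?ltW ?growth_defect_gt0 // denominatorM_raw -mulrA; congr (_ * _).
rewrite powRM ?powR_ge0 ?invr_ge0 ?powR_ge0 // -powRrM [beta * t]mulrC mulrAC.
rewrite divff ?gt_eqF ?powR_gt0 // mul1r -powRN -powRrM; congr (_ `^ _).
by rewrite mulNr divfK // gt_eqF.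
Qed.

Lemma growth_ratio_ge k : (0 < k)%N ->
  k.+1%:R `^ (- r) <= (q k.+1)%:R `^ t / (q k)%:R `^ s.
Proof.
move=> k0; rewrite growth_ratioE ler_peMl ?powR_ge0 //.
have /andP[h _] := growth_defect_itv k0.
have {1}-> : 1 = 1 `^ t :> R by rewrite powR1.
by rewrite ge0_ler_powR ?nnegrE ?(ltW t_gt0) // ltW // growth_defect_gt0.
Qed.

Lemma growth_defect_powR_cvg1 : W k `^ t @[k --> \oo] --> (1 : R).
Proof.
have {1}-> : 1 = 1 `^ t :> R by rewrite powR1.
exact: cvg_powR_seq growth_defect_cvg1.
Qed.

Lemma growth_ratio_bounded : exists2 M : R, 0 < M &
  forall k, (q k.+1)%:R `^ t / (q k)%:R `^ s <= M * k.+1%:R `^ (- r).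
Proof.
have /cvg_seq_bounded : cvgn (fun k => W k `^ t).
  by apply/cvg_ex; exists 1; exact: growth_defect_powR_cvg1.
move=> [M [_ /(_ (`|M| + 1))]] h.
(* Boundedness makes every real above [M] a bound; this one is also positive. *)
exists (`|M| + 1); first by rewrite ltr_pwDr.
move=> k; rewrite growth_ratioE ler_wpM2r ?powR_ge0 //.
have lt_M : M < `|M| + 1 by rewrite (le_lt_trans (ler_norm M)) // ltrDl.
by have := h lt_M k I; rewrite /= ger0_norm ?powR_ge0.
Qed.

Lemma ln_denominator_ratio_cvg :
  ln (q k.+1)%:R / ln (q k)%:R @[k --> \oo] --> beta.
Proof.
(* The logarithm of q_(k+1) = W_k q_k^beta / (k+1)^(r/t), divided by ln q_k. *)
have h : beta + (ln (W k) * (ln (q k)%:R)^-1 - r / t * (ln k.+1%:R / ln (q k)%:R))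
    @[k --> \oo] --> beta + (0 * 0 - r / t * 0).
  apply: cvgD; first exact: cvg_cst.
  apply: cvgB; last by apply: cvgMr; exact: ln_ratio_cvg0.
  apply: cvgM; last exact: ln_denominatorV_cvg0.
  rewrite -ln1; apply: (continuous_cvg _ _ growth_defect_cvg1).
  exact: continuous_ln.
rewrite !mulr0 subr0 addr0 in h; apply: cvg_trans h; apply: near_eq_cvg.
exists 1%N => // k k0.
have -> : (q k.+1)%:R = W k * ((q k)%:R * A k) by rewrite divfK // gt_eqF.
rewrite lnM ?posrE ?growth_defect_gt0 // denominatorM_raw.
rewrite ln_div ?posrE ?powR_gt0 // !ln_powR.
by field; rewrite !gt_eqF ?ln_denominator_gt0.
Qed.

Lemma denominator_ratio_cvg0 : (q k)%:R / (q k.+1)%:R @[k --> \oo] --> (0 : R).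
Proof.
apply: (@squeeze_cvgr _ _ _ _ (cst 0) (fun k => (A k)^-1)).
- exists 1%N => // k k0; rewrite divr_ge0 //= ler_pdivrMr //.
  have /andP[h _] := growth_defect_itv k0.
  rewrite ler_pdivlMr // mul1r in h.
  by rewrite -ler_pdivrMl ?invr_gt0 ?raw_quotient_gt0 // invrK mulrC.
- exact: cvg_cst.
- exact: raw_quotientV_cvg0.
Qed.

End Growth.

(** * Convergence of the series and irrationality exponent *)

(** The determinant identity is a Bézout relation. Coprimality identifies q_n as the reduced
    denominator of the convergent, which the irrationality exponent refers to. *)
Lemma cf_coprime a n : coprime (cf_num a n) (cf_den a n).
Proof.
have := cf_det a n; rewrite !natrM => det.
pose e : int := (-1) ^+ n; have ee : e * e = 1 by rewrite -exprMn mulrNN mul1r expr1n.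
suff : coprimez (cf_num a n) (cf_den a n) by [].
apply/coprimezP; exists (- e * (cf_den a n.+1)%:R, e * (cf_num a n.+1)%:R) => /=.
rewrite -[RHS]ee; rewrite -/e in det; rewrite -[X in _ = _ * X]det !natz; ring.
Qed.

Section Terms.
Context {R : realType}.
Variables (t beta r : R).
Hypotheses (t_gt1 : 1 < t) (beta_gt1 : 1 < beta) (r_ge0 : 0 <= r).

Let t_gt0 : 0 < t. Proof. exact: lt_trans t_gt1. Qed.
Let t_ge0 : 0 <= t. Proof. exact: ltW. Qed.
Let beta_gt0 : 0 < beta. Proof. exact: lt_trans beta_gt1. Qed.
Let s := t * beta.
Let s_gt0 : 0 < s. Proof. exact: mulr_gt0. Qed.
Let a := partial_quotient t beta r.
Let q := denominator t beta r.
Let x := xr t beta r.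
Let u := summand s t x.
Local Notation d k := (dist_int ((q k)%:R * x)).

Let a_gt0 k : (0 < k)%N -> (0 < a k)%N.
Proof. exact: partial_quotient_gt0. Qed.

Let qE : q = cf_den a. Proof. exact: denominatorE. Qed.

Let q_gt0 k : 0 < (q k)%:R :> R.
Proof. by rewrite ltr0n denominator_gt0. Qed.

Let dE k : d k = cf_error a k.
Proof. by rewrite qE; exact: dist_int_cf_den. Qed.

Lemma dist_denominator_gt k : ((q k.+1)%:R + (q k)%:R)^-1 < d k.
Proof. by rewrite dE qE; exact: cf_error_gt. Qed.

Lemma dist_denominator_lt k : d k < (q k.+1)%:R^-1.
Proof. by rewrite dE qE; exact: cf_error_lt. Qed.

Lemma dist_denominator_gt0 k : 0 < d k.
Proof. by rewrite dE; exact: cf_error_gt0. Qed.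

Lemma dist_denominator_min k n : (0 < n < q k.+1)%N -> d k <= dist_int (n%:R * x).
Proof. by rewrite dE qE; exact: cf_error_le_dist_int. Qed.

Lemma denominator_block n : (0 < n)%N -> exists k, (q k <= n < q k.+1)%N.
Proof.
move=> n0; have [k kn] : exists k, (n < q k)%N by exists n; exact: denominator_ge.
elim: k kn => [|k ih] kn; first by rewrite ltnNge n0 in kn.
by have [lt|le] := ltnP n (q k); [exact: ih|exists k; rewrite le].
Qed.

Lemma denominator_homo : {homo q : m n / (m < n)%N}.
Proof. by apply: homo_ltn ltn_trans _ => k; exact: denominator_ltS. Qed.

Lemma summandE n : u n = 1 / (n%:R `^ s * `|sin (pi * n%:R * x)| `^ t).
Proof. by rewrite /u /summand !powRN mul1r invfM. Qed.

Lemma summand_ge0 n : 0 <= u n.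
Proof. by rewrite mulr_ge0 ?powR_ge0. Qed.

Local Notation bound k :=
  (((q k.+1)%:R + (q k)%:R) `^ t / (2 `^ t * (q k)%:R `^ s)).

Lemma summand_le_bound k n : (q k <= n < q k.+1)%N -> u n <= bound k.
Proof.
move=> /andP[qn nq].
have n0 : (0 < n)%N by rewrite (leq_trans _ qn) // denominator_gt0.
have sq : 0 < (q k.+1)%:R + (q k)%:R :> R by rewrite addr_gt0.
have -> : bound k = (q k)%:R `^ (- s) * (2 / ((q k.+1)%:R + (q k)%:R)) `^ (- t).
  rewrite powRM ?invr_ge0 ?(ltW sq) // -(powR_inv1 (ltW sq)) -powRrM mulN1r opprK.
  by rewrite !powRN; field; rewrite !gt_eqF ?powR_gt0.
rewrite ler_pM ?powR_ge0 ?ler_powRN ?(ltW s_gt0) ?ler_nat ?divr_gt0 //.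
rewrite -mulrA (le_trans _ (norm_sin_ge _)) // ler_pM2l // ltW //.
rewrite (lt_le_trans (dist_denominator_gt k)) // dist_denominator_min //.
by rewrite n0.
Qed.

Lemma bound_le_ratio k : bound k <= (q k.+1)%:R `^ t / (q k)%:R `^ s.
Proof.
rewrite invfM mulrA ler_pM2r ?invr_gt0 ?powR_gt0 // ler_pdivrMr ?powR_gt0 //.
rewrite -powRM ?ler0n // ge0_ler_powR ?nnegrE ?mulr_ge0 ?addr_ge0 ?ler0n //.
have : (q k)%:R <= (q k.+1)%:R :> R by rewrite ler_nat ltnW // denominator_ltS.
lra.
Qed.

Lemma bound_ge0 k : 0 <= bound k.
Proof. by rewrite divr_ge0 ?mulr_ge0 ?powR_ge0. Qed.

Lemma bound_bigO : exists2 M : R, 0 < M & forall k, bound k <= M * k.+1%:R `^ (- r).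
Proof.
have [M M0 h] := growth_ratio_bounded t_gt1 beta_gt1 r_ge0.
by exists M => // k; exact: le_trans (bound_le_ratio k) (h k).
Qed.

Lemma summand_denominator_ge k :
  pi `^ (- t) * ((q k.+1)%:R `^ t / (q k)%:R `^ s)
    < pi `^ (- t) * (1 / ((q k)%:R `^ s * d k `^ t))
    <= u (q k).
Proof.
have pi0 := pi_gt0 R; have d0 := dist_denominator_gt0 k.
have piN : 0 < pi `^ (- t) :> R by rewrite powR_gt0.
apply/andP; split.
  rewrite ltr_pM2l // mul1r invfM mulrC ltr_pM2l ?invr_gt0 ?powR_gt0 //.
  rewrite -[ltLHS]invrK ltf_pV2 ?posrE ?invr_gt0 ?powR_gt0 //.
  have -> : ((q k.+1)%:R `^ t)^-1 = (q k.+1)%:R^-1 `^ t :> R.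
    by rewrite -powR_inv1 ?powR_ge0 // -powRrM mulrC powRrM powR_inv1 // ltW.
  by rewrite gt0_ltr_powR ?nnegrE ?invr_ge0 ?(ltW d0) ?ler0n // dist_denominator_lt.
have s0 : 0 < `|sin (pi * ((q k)%:R * x))|.
  by rewrite (lt_le_trans _ (norm_sin_ge _)) // mulr_gt0.
have -> : pi `^ (- t) * (1 / ((q k)%:R `^ s * d k `^ t)) =
    (q k)%:R `^ (- s) * (pi * d k) `^ (- t).
  by rewrite !powRN (powRM _ (ltW pi0) (ltW d0)); field; rewrite !gt_eqF ?powR_gt0.
by rewrite /u /summand -mulrA ler_wpM2l ?powR_ge0 // ler_powRN // norm_sin_le.
Qed.

Let ratio_ge k : k.+1%:R `^ (- r) <= (q k.+1)%:R `^ t / (q k)%:R `^ s.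
Proof.
case: k => [|k]; last exact: growth_ratio_ge.
(* At k = 0 the ratio is 2^t, because q_0 = 1 and q_1 = 2. *)
by rewrite /q /denominator /= !mulr1n !powR1 divr1 powR_ge1 // ler1n.
Qed.

Let sum_blocks K :
  \sum_(1 <= n < q K) u n = \sum_(0 <= k < K) \sum_(q k <= n < q k.+1) u n.
Proof.
elim: K => [|K ih]; first by rewrite !big_geq.
rewrite [RHS]big_nat_recr //= -ih -big_cat_nat //; first exact: denominator_gt0.
by rewrite ltnW // denominator_ltS.
Qed.

Let sum_summand_le (n N : nat) : (n <= N)%N ->
  \sum_(1 <= i < n) u i <= \sum_(1 <= i < N) u i.
Proof.
move=> nN; have [n1|n1] := leqP 1 n.
  by rewrite (big_cat_nat n1 nN) lerDl sumr_ge0 // => i _; exact: summand_ge0.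
by rewrite big_geq 1?ltnW // sumr_ge0 // => i _; exact: summand_ge0.
Qed.

Lemma sine_series_lty : 1 < r -> (sine_series s t x < +oo)%E.
Proof.
move=> r1; have [M M0 hM] := growth_ratio_bounded t_gt1 beta_gt1 r_ge0.
(* [B] bounds zeta(t), 2^t comes from q_(k+1) + q_k <= 2 q_(k+1), and [M] bounds the growth ratio
   relative to (k+1)^(-r). *)
pose B := t / (t - 1); pose C := 2 * B * (2 `^ t * M).
have B0 : 0 <= B by rewrite divr_ge0 // subr_ge0 ltW.
have C0 : 0 <= C.
  exact: (mulr_ge0 (mulr_ge0 (ler0n _ 2) B0) (mulr_ge0 (powR_ge0 _ _) (ltW M0))).
have block k : \sum_(q k <= n < q k.+1) u n <= C * k.+1%:R `^ (- r).
  have := @summand_block_le R a a_gt0 s t B k (ltW s_gt0) t_ge0 (fun N => sum_powRN_le N t_gt1).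
  rewrite -qE => /le_trans; apply; rewrite /C -[leRHS]mulrA ler_wpM2l ?(mulr_ge0 (ler0n _ 2) B0) //.
  rewrite -mulrA (le_trans _ (ler_wpM2l (powR_ge0 2 t) (hM k))) // mulrA.
  rewrite ler_pM2r ?invr_gt0 ?powR_gt0 // -powRM // ge0_ler_powR ?nnegrE ?addr_ge0 ?mulr_ge0 //.
  have : (q k)%:R <= (q k.+1)%:R :> R by rewrite ler_nat ltnW // denominator_ltS.
  lra.
apply: (@le_lt_trans _ _ (C * (r / (r - 1)))%:E); last exact: ltry.
apply: lime_le.
  by apply: is_cvg_nneseries => n _ _; rewrite lee_fin summand_ge0.
apply: nearW => N; rewrite sumEFin lee_fin.
(* Since N < q_N, the partial sum can be enlarged to a union of whole blocks. *)
rewrite (le_trans (sum_summand_le (ltnW (denominator_ge t beta r N)))) // sum_blocks.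
rewrite (le_trans (ler_sum_nat (fun k _ => block k))) // -mulr_sumr ler_wpM2l //.
have := @sum_powRN_le R r N.+1 r1.
by rewrite -{1}[1%N]add0n -[N.+1]addn1 big_addn addn1 subn1; under eq_bigr do rewrite addn1.
Qed.

(** Only the first term n = q_k of each block is kept; it is at least pi^(-t) (k+1)^(-r). *)
Lemma sine_series_pinfty : r <= 1 -> sine_series s t x = +oo%E.
Proof.
move=> r1; apply/eqyP => M M0.
have pi0 : 0 < pi `^ (- t) :> R by rewrite powR_gt0 // pi_gt0.
have : series (riemannR r) @ \oo --> (+oo : set_system R).
  apply: nondecreasing_dvgn_lt; last by apply: dvg_riemannR; rewrite r_ge0.
  by apply: nondecreasing_series => n _ _; rewrite ltW // riemannR_gt0.
move/cvgryPge => /(_ (M / pi `^ (- t))) [K _ /(_ K (leqnn K))] hK.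
apply: (@le_trans _ _ (\sum_(1 <= n < q K) u n)%:E); last first.
  rewrite -sumEFin; apply: nneseries_lim_ge => n _ _.
  by rewrite lee_fin summand_ge0.
rewrite lee_fin sum_blocks; rewrite ler_pdivrMr // in hK.
rewrite (le_trans hK) // /series /= mulr_suml ler_sum_nat // => k _.
rewrite /riemannR -powRN (@le_trans _ _ (u (q k))) //.
  have /andP[/ltW h1 h2] := summand_denominator_ge k.
  by rewrite (le_trans _ (le_trans h1 h2)) // mulrC ler_pM2l.
rewrite big_ltn ?denominator_ltS // lerDl sumr_ge0 // => n _.
exact: summand_ge0.
Qed.

Let tau := beta + 1.

(** A denominator b in the block of q_k satisfies q_(k+1) <= M' q_k^beta <= M' b^beta, so every
    fraction p / b is at distance at least 1 / (C b^tau) from x. An exponent above tau then bounds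
    b, and with it p. *)
Lemma irrationality_exponent_le (tau' : R) : tau < tau' ->
  finite_set [set p : rat | `|x - ratr p| < (denq p)%:~R `^ (- tau')].
Proof.
move=> tt'; have [M M0 hM] := growth_ratio_bounded t_gt1 beta_gt1 r_ge0.
have tau0 : 0 < tau by rewrite addr_gt0.
have tau'0 : 0 < tau' by exact: lt_trans tt'.
(* The t-th root of the bound on q_(k+1)^t / q_k^s, with (k+1)^(-r) <= 1 dropped. *)
pose M' := M `^ t^-1.
have M'0 : 0 < M' by rewrite powR_gt0.
have qle k : (q k.+1)%:R <= M' * (q k)%:R `^ beta :> R.
  have h : (q k.+1)%:R `^ t <= M * (q k)%:R `^ s.
    rewrite -ler_pdivrMr ?powR_gt0 // (le_trans (hM k)) // ler_piMr ?(ltW M0) //.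
    by rewrite powRN invf_le1 ?powR_gt0 // powR_ge1 // ler1n.
  have := ge0_ler_powR (_ : 0 <= t^-1) (powR_ge0 _ _) _ h.
  rewrite !nnegrE invr_ge0 t_ge0 mulr_ge0 ?powR_ge0 ?(ltW M0) //.
  rewrite powRM ?powR_ge0 ?(ltW M0) // -!powRrM divff ?gt_eqF // powRr1 //.
  by rewrite /s [t * _]mulrC mulfK ?gt_eqF //; apply.
pose C := 2 * M'.
have lower p : (C * (denq p)%:~R `^ tau)^-1 <= `|x - ratr p|.
  have b0 : (0 < `|denq p|)%N by rewrite absz_gt0 denq_neq0.
  have bE : (denq p)%:~R = (`|denq p|)%:R :> R.
    by rewrite pmulrn gez0_abs // ltW // denq_gt0.
  have [k /andP[kb bk]] := denominator_block b0.
  set b := `|denq p|%N in b0 bE kb bk *.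
  have bR : 0 < b%:R :> R by rewrite ltr0n.
  have := @cf_best_approx R a a_gt0 k b (numq p).
  rewrite b0 -qE bk => /(_ isT); rewrite -/x -dE => hd.
  have -> : x - ratr p = (b%:R * x - (numq p)%:~R) / b%:R.
    by rewrite /ratr bE; field; rewrite gt_eqF.
  rewrite normrM normfV (gtr0_norm bR) ler_pdivlMr // bE (le_trans _ hd) //.
  rewrite (le_trans _ (ltW (dist_denominator_gt k))) //.
  have -> : b%:R `^ tau = b%:R `^ beta * b%:R :> R.
    by rewrite powRD ?powRr1 ?ler0n // (gt_eqF bR) implybT.
  rewrite mulrA [(_ * b%:R)^-1]invfM mulfVK ?gt_eqF //.
  rewrite lef_pV2 ?posrE ?addr_gt0 ?mulr_gt0 ?powR_gt0 //.
  have h1 : (q k)%:R <= (q k.+1)%:R :> R by rewrite ler_nat ltnW // denominator_ltS.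
  have h2 : (q k)%:R `^ beta <= b%:R `^ beta :> R.
    by rewrite ge0_ler_powR ?nnegrE ?(ltW beta_gt0) ?ler0n // ler_nat.
  have h3 := ler_wpM2l (ltW M'0) h2; have h4 := qle k; rewrite /C -mulrA; lra.
pose N := (Num.truncn (C `^ (tau' - tau)^-1)).+1.
pose K := (Num.truncn ((`|x| + 1) * N%:R)).+1.
(* Writing the numerator as a difference of naturals presents the solutions as part of the image of
   a finite box. *)
pose g (z : nat * nat * nat) : rat := (z.1.1%:Z - z.1.2%:Z)%:~R / (z.2%:Z)%:~R.
apply: (@sub_finite_set _ _ (g @` (`I_K `*` `I_K `*` `I_N))); last first.
  by apply: finite_image; do !apply: finite_setX; exact: finite_II.
move=> p /= hp.
have b0 : 0 < (denq p)%:~R :> R by rewrite ltr0z denq_gt0.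
have b1 : 1 <= (denq p)%:~R :> R by rewrite ler1z -gtz0_ge1 denq_gt0.
have bE : (denq p)%:~R = (`|denq p|)%:R :> R.
  by rewrite pmulrn gez0_abs // ltW // denq_gt0.
have bN : (denq p)%:~R < N%:R :> R.
  rewrite (lt_trans _ (truncnS_gt _)) //.
  have h := le_lt_trans (lower p) hp.
  have h2 : (denq p)%:~R `^ (tau' - tau) < C.
    rewrite powRB ?(gt_eqF b0) ?implybT // ltr_pdivrMr ?powR_gt0 //.
    by rewrite -ltf_pV2 ?posrE ?mulr_gt0 ?powR_gt0 // -powRN.
  have tp : 0 < tau' - tau by rewrite subr_gt0.
  have := gt0_ltr_powR (_ : 0 < (tau' - tau)^-1) _ _ h2.
  rewrite invr_gt0 tp !nnegrE powR_ge0 mulr_ge0 ?(ltW M'0) //.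
  by rewrite -powRrM divff ?gt_eqF // powRr1 ?(ltW b0) //; apply.
have p1 : `|ratr p| < `|x| + 1.
  have : `|x - ratr p| < 1.
    by rewrite (lt_le_trans hp) // powRN invf_le1 ?powR_gt0 // powR_ge1 // ltW.
  have := ler_normB x (x - ratr p); rewrite opprB addrC subrK; lra.
have nK : (`|numq p| < K)%N.
  rewrite -(ltr_nat R) (lt_trans _ (truncnS_gt _)) //.
  have -> : (`|numq p|)%:R = `|ratr p| * (denq p)%:~R :> R.
    by rewrite /ratr normrM normfV (gtr0_norm b0) divfK ?gt_eqF // pmulrn abszE intr_norm.
  by rewrite ltr_pM // ltW.
have K0 : (0 < K)%N by [].
pose nn := 0 <= numq p.
exists (if nn then `|numq p| else 0, if nn then 0 else `|numq p|, `|denq p|)%N.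
  split; last by rewrite /= -(ltr_nat R) -bE.
  by split => /=; case: ifP.
have de : (`|denq p|)%:Z = denq p by rewrite gez0_abs // ltW // denq_gt0.
rewrite /g /= de -[RHS]divq_num_den /nn; congr (_%:~R / _).
by case: (leP 0 (numq p)) => h; [rewrite subr0 gez0_abs|rewrite sub0r ltz0_abs ?opprK].
Qed.

(** Finitely many fractions stay at a positive distance [delta] from the irrational x. For tau' <
    tau, a late convergent satisfies the condition, so it is one of them, yet it is closer to x than
    [delta]. *)
Lemma irrationality_exponent_ge (tau' : R) : 0 < tau' ->
  finite_set [set p : rat | `|x - ratr p| < (denq p)%:~R `^ (- tau')] -> tau <= tau'.
Proof.
move=> tau'0 /finite_seqP[l lE]; rewrite leNgt; apply/negP => tt'.
pose c k : rat := (cf_num a k)%:Z%:~R / (cf_den a k)%:Z%:~R.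
have cden k : denq (c k) = (cf_den a k)%:Z.
  rewrite coprimeq_den ?cf_coprime //; case: ifP => // /eqP[h].
  by have := cf_den_gt0 a_gt0 k; rewrite h.
have cE k : ratr (c k) = (cf_num a k)%:R / (cf_den a k)%:R :> R.
  by rewrite /c fmorph_div /= !ratr_int -!pmulrn.
have cx k : `|x - ratr (c k)| = d k / (q k)%:R.
  rewrite cE -qE dE /cf_error -qE -/x.
  have -> : x - (cf_num a k)%:R / (q k)%:R = ((q k)%:R * x - (cf_num a k)%:R) / (q k)%:R.
    by rewrite mulrBl mulrAC divff ?mul1r // gt_eqF.
  by rewrite normrM normfV (gtr0_norm (q_gt0 k)).
have [delta delta0 hdelta] : exists2 delta : R, 0 < delta &
    forall p, p \in l -> delta <= `|x - ratr p|.
  elim: {lE} l => [|p l [delta d0 h]]; first by exists 1.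
  have xp : 0 < `|x - ratr p|.
    rewrite normr_gt0 subr_eq0; apply/eqP => xp.
    by have := @irrational_cf_value R a a_gt0; apply; exists p.
  exists (Num.min delta `|x - ratr p|); first by rewrite lt_min d0.
  move=> p'; rewrite inE => /orP[/eqP->|/h h']; first by rewrite ge_min lexx orbT.
  by rewrite ge_min h'.
have rho0 : 0 <= r / t by rewrite divr_ge0.
have dtau : 0 < tau - tau' by rewrite subr_gt0.
(* This is exactly what turns 1 / q_(k+1) <= (k+1)^(r/t) / q_k^beta into a bound by q_k^(1 -
   tau'). *)
have : \forall k \near \oo, 1 <= (q k)%:R `^ (tau - tau') / k.+1%:R `^ (r / t).
  exact/(cvgryPge _).1/powR_denominator_dominates.
move=> near1; have [k] : exists k, [/\ (0 < k)%N, delta^-1 <= k%:R &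
    1 <= (q k)%:R `^ (tau - tau') / k.+1%:R `^ (r / t)].
  near \oo => k; exists k; split; near: k.
  - exact: nbhs_infty_gt.
  - exact: nbhs_infty_ger.
  - exact: near1.
move=> [k0 kd kdom].
have : c k \in l.
  suff : [set` l] (c k) by [].
  rewrite -lE /= cx cden -qE -pmulrn ltr_pdivrMr //.
  rewrite (lt_le_trans (dist_denominator_lt k)) //.
  have -> : (q k)%:R `^ (- tau') * (q k)%:R =
      ((q k)%:R `^ beta / (q k)%:R `^ (tau - tau'))^-1 :> R.
    rewrite -powRB ?(gt_eqF (q_gt0 k)) ?implybT // -powRN -{2}[(q k)%:R]powRr1 ?ler0n //.
    by rewrite -powRD ?(gt_eqF (q_gt0 k)) ?implybT //; congr (_ `^ _); rewrite /tau; ring.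
  rewrite lef_pV2 ?posrE ?divr_gt0 ?powR_gt0 //.
  have /andP[h _] := growth_defect_itv t beta r k0.
  have qA : 0 < (q k)%:R * raw_quotient t beta r k by rewrite mulr_gt0 ?raw_quotient_gt0.
  rewrite /growth_defect (ler_pdivlMr _ _ qA) mul1r denominatorM_raw // in h.
  apply: le_trans h; rewrite ler_pM2l ?powR_gt0 // lef_pV2 ?posrE ?powR_gt0 //.
  by rewrite ler_pdivlMr ?powR_gt0 // mul1r in kdom.
move/hdelta; rewrite cx leNgt => /negP; apply.
have kq : k%:R < (q k.+1)%:R :> R by rewrite ltr_nat ltnW // denominator_ge.
have kp : 0 < k%:R :> R by rewrite ltr0n.
rewrite ltr_pdivrMr // (lt_le_trans (dist_denominator_lt k)) //.
rewrite (@le_trans _ _ delta) ?ler_peMr ?(ltW delta0) ?ler1n ?denominator_gt0 //.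
by rewrite -[leRHS]invrK lef_pV2 ?posrE ?invr_gt0 // (le_trans kd) // ltW.
Unshelve. all: by end_near. Qed.

Lemma irrationality_exponentE : irrationality_exponent x = tau%:E.
Proof.
have tau0 : 0 < tau by rewrite addr_gt0.
apply/eqP; rewrite eq_le; apply/andP; split.
  apply/lee_addgt0Pr => e e0; apply: ereal_inf_lbound.
  exists (tau + e) => //; split; first exact: addr_gt0.
  by apply: irrationality_exponent_le; rewrite ltrDl.
apply: le_ereal_inf_tmp => _ [tau' [h1 h2] <-].
by rewrite lee_fin irrationality_exponent_ge.
Qed.

End Terms.

(** * Limits of the summands *)

Lemma homo_ltn_ge (phi : nat -> nat) : {homo phi : m n / (m < n)%N} ->
  forall n, (n <= phi n)%N.
Proof. by move=> h; elim=> // n ih; rewrite (leq_ltn_trans ih) // h. Qed.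

Lemma cvg_subsequence (R : realType) (u : R^nat) (l : R) (phi : nat -> nat) :
  {homo phi : m n / (m < n)%N} -> u @ \oo --> l -> u (phi n) @[n --> \oo] --> l.
Proof.
move=> h; apply: cvg_comp => A [N _ NA].
by exists N => // n /= Nn; apply: NA; rewrite /= (leq_trans Nn) // homo_ltn_ge.
Qed.

Lemma subsequential_limit_unique (R : realType) (u : R^nat) (l l' : R) :
  u @ \oo --> l -> subsequential_limit u l' -> l' = l.
Proof.
move=> ul [phi h ul']; apply: (cvg_unique _ ul'); first exact: norm_hausdorff.
exact: cvg_subsequence.
Qed.

Lemma cvg_succ_powRN (R : realType) (p : R) : 0 < p ->
  n.+1%:R `^ (- p) @[n --> \oo] --> (0 : R).
Proof.
move=> p0; under eq_fun do rewrite powRN.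
apply/gtr0_cvgV0; first by apply: nearW => n; rewrite powR_gt0.
apply/cvgryPge => M; near=> n.
have h : `|M| `^ p^-1 <= n.+1%:R.
  rewrite (@le_trans _ _ n%:R) ?ler_nat //; near: n; exact: nbhs_infty_ger.
rewrite (le_trans (ler_norm M)) //.
have {1}-> : `|M| = (`|M| `^ p^-1) `^ p by rewrite -powRrM mulVf ?powRr1 // gt_eqF.
by rewrite ge0_ler_powR ?nnegrE ?powR_ge0 // ltW.
Unshelve. all: by end_near. Qed.

Section TermLimits.
Context {R : realType}.
Variables (t beta r : R).
Hypotheses (t_gt1 : 1 < t) (beta_gt1 : 1 < beta) (r_ge0 : 0 <= r).

Let t_gt0 : 0 < t. Proof. exact: lt_trans t_gt1. Qed.
Let t_ge0 : 0 <= t. Proof. exact: ltW. Qed.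
Let beta_gt0 : 0 < beta. Proof. exact: lt_trans beta_gt1. Qed.
Let s := t * beta.
Let s_gt0 : 0 < s. Proof. exact: mulr_gt0. Qed.
Let q := denominator t beta r.
Let x := xr t beta r.
Let u := summand s t x.
Local Notation d k := (dist_int ((q k)%:R * x)).
Local Notation bound k :=
  (((q k.+1)%:R + (q k)%:R) `^ t / (2 `^ t * (q k)%:R `^ s)).

Let q_gt0 k : 0 < (q k)%:R :> R.
Proof. by rewrite ltr0n denominator_gt0. Qed.

Let d_gt0 k : 0 < d k.
Proof. exact: dist_denominator_gt0. Qed.

Let d_lt k : d k < k.+1%:R^-1.
Proof.
have lt1 : d k < (q k.+1)%:R^-1 by exact: dist_denominator_lt.
apply: lt_trans lt1 _; rewrite ltf_pV2 ?posrE // ltr_nat.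
exact: denominator_ge.
Qed.

Lemma bound_cvg0 : 0 < r -> bound k @[k --> \oo] --> (0 : R).
Proof.
move=> r0; have [M M0 hM] := bound_bigO t_gt1 beta_gt1 r_ge0.
apply: (@squeeze_cvgr _ _ _ _ (cst 0) (fun k => M * k.+1%:R `^ (- r))).
- by apply: nearW => k; rewrite hM andbT; exact: bound_ge0.
- exact: cvg_cst.
- by rewrite -[X in _ --> X](mulr0 M); apply: cvgMr; exact: cvg_succ_powRN.
Qed.

Lemma summand_cvg0 : 0 < r -> u @ \oo --> (0 : R).
Proof.
move=> r0; apply/cvgrPdist_le => e e0.
have /cvgrPdist_le/(_ e e0)[K _ hK] := bound_cvg0 r0.
(* An index n >= q_K lies in a block k >= K. *)
exists (q K) => // n /= qn.
have n0 : (0 < n)%N by rewrite (leq_trans _ qn) // denominator_gt0.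
have [k /andP[kn nk]] := denominator_block t beta r n0.
have Kk : (K <= k)%N.
  rewrite leqNgt; apply/negP => kK.
  have := ltnW_homo (denominator_homo t beta r) kK.
  by rewrite leqNgt (leq_ltn_trans qn nk).
rewrite sub0r normrN ger0_norm ?summand_ge0 //.
rewrite (le_trans (summand_le_bound t_gt1 beta_gt1 (introT andP (conj kn nk)))) //.
have := hK k Kk; rewrite /= sub0r normrN; apply: le_trans; exact: ler_norm.
Qed.

(** The counterpart of [summand_denominator_ge]: here y cos y <= sin y is used, so that the extra
    factor tends to 1. The cosine is positive because q_(k+1) >= 2 gives d_k < 1/2. *)
Lemma summand_denominator_le k :
  u (q k) <= pi `^ (- t) * ((q k.+1)%:R `^ t / (q k)%:R `^ s) *
     ((1 + (q k)%:R / (q k.+1)%:R) `^ t * cos (pi * d k) `^ (- t)).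
Proof.
have pi0 := pi_gt0 R; have d0 := d_gt0 k.
have c0 : 0 < cos (pi * d k).
  apply: cos_gt0_pihalf; rewrite (@lt_le_trans _ _ 0) ?oppr_lt0 ?divr_gt0 ?mulr_ge0 ?ltW //=.
  rewrite ltr_pM2l // (lt_le_trans (dist_denominator_lt t beta r k)) //.
  by rewrite lef_pV2 ?posrE // ler_nat (leq_ltn_trans _ (denominator_ge t beta r k.+1)).
have sq : 0 < (q k.+1)%:R + (q k)%:R :> R by rewrite addr_gt0.
pose e := pi * ((q k.+1)%:R + (q k)%:R)^-1 * cos (pi * d k).
have e0 : 0 < e by rewrite !mulr_gt0 ?invr_gt0.
have ue : u (q k) <= (q k)%:R `^ (- s) * e `^ (- t).
  rewrite /u /summand ler_wpM2l ?powR_ge0 // ler_powRN // -mulrA.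
  apply: le_trans (norm_sin_ge_cos _); rewrite ler_pM2r // ler_pM2l // ltW //.
  exact: dist_denominator_gt.
apply: le_trans ue _.
have -> : 1 + (q k)%:R / (q k.+1)%:R = ((q k.+1)%:R + (q k)%:R) / (q k.+1)%:R :> R.
  by rewrite mulrDl divff // gt_eqF.
rewrite /e !powRM ?mulr_ge0 ?invr_ge0 ?(ltW c0) ?(ltW pi0) ?(ltW sq) ?(ltW (q_gt0 _)) //.
have -> : ((q k.+1)%:R + (q k)%:R)^-1 `^ (- t) = ((q k.+1)%:R + (q k)%:R) `^ t :> R.
  by rewrite -(powR_inv1 (ltW sq)) -powRrM mulN1r opprK.
have -> : (q k.+1)%:R^-1 `^ t = ((q k.+1)%:R `^ t)^-1 :> R.
  by rewrite -(powR_inv1 (ltW (q_gt0 _))) -powRrM mulN1r powRN.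
rewrite le_eqVlt; apply/orP; left; apply/eqP.
by rewrite !powRN; field; rewrite !gt_eqF ?powR_gt0.
Qed.

Lemma dist_denominatorS_cvg : dist_int ((q k).+1%:R * x) @[k --> \oo] --> dist_int x.
Proof.
apply/cvgrPdist_le => e e0; near=> k.
have hd : d k <= e.
  rewrite ltW // (lt_trans (d_lt k)) //; near: k.
  exact: (near_infty_natSinv_lt (PosNum e0)).
have E : (q k).+1%:R * x = (q k)%:R * x + x by rewrite -natr1 mulrDl mul1r.
have h1 := dist_intD ((q k)%:R * x) x; rewrite -E in h1.
have h2 := dist_intD ((q k).+1%:R * x) (- ((q k)%:R * x)).
rewrite dist_intN E addrAC subrr add0r -E in h2.
by rewrite ler_norml; apply/andP; split; lra.
Unshelve. all: by end_near. Qed.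

Lemma dist_int_xr_gt0 : 0 < dist_int x.
(* Here q_0 = 1, so the distance of x itself is that of q_0 x. *)
Proof. by have := d_gt0 0; rewrite mul1r. Qed.

Lemma summand_denominatorS_cvg0 : u (q k).+1 @[k --> \oo] --> (0 : R).
Proof.
have x0 := dist_int_xr_gt0.
apply: (@squeeze_cvgr _ _ _ _ (cst 0) (fun k => dist_int x `^ (- t) * k.+1%:R `^ (- s))).
(* With tolerance half of the distance of x to the integers, the factor 2 of the chord bound makes
   the sine at least that full distance. *)
- have /cvgrPdist_lt/(_ _ (divr_gt0 x0 (ltr0Sn R 1))) h := dist_denominatorS_cvg.
  near=> k; rewrite mulr_ge0 ?powR_ge0 //= mulrC ler_pM ?powR_ge0 //.
    by rewrite ler_powRN ?(ltW s_gt0) // ler_nat ltnS ltnW // denominator_ge.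
  rewrite ler_powRN // -mulrA (le_trans _ (norm_sin_ge _)) //.
  have : `|dist_int x - dist_int ((q k).+1%:R * x)| < dist_int x / 2 by near: k.
  by rewrite ltr_norml => /andP[]; lra.
- exact: cvg_cst.
- by rewrite -[X in _ --> X](mulr0 (dist_int x `^ (- t))); apply: cvgMr; exact: cvg_succ_powRN.
Unshelve. all: by end_near. Qed.

End TermLimits.

(** * The case r = 0: the terms at n = q_k *)

Section ZeroExponent.
Context {R : realType}.
Variables (t beta : R).
Hypotheses (t_gt1 : 1 < t) (beta_gt1 : 1 < beta).

Let s := t * beta.
Let q := denominator t beta 0.
Let x := xr t beta 0.
Let u := summand s t x.

Lemma growth_ratio_cvg1 : (q k.+1)%:R `^ t / (q k)%:R `^ s @[k --> \oo] --> (1 : R).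
Proof.
have := growth_defect_powR_cvg1 t_gt1 beta_gt1 (lexx 0).
apply: cvg_trans; apply: near_eq_cvg; apply: nearW => k.
by rewrite growth_ratioE // oppr0 powRr0 mulr1.
Qed.

Lemma scaled_growth_ratio_cvg :
  pi `^ (- t) * ((q k.+1)%:R `^ t / (q k)%:R `^ s) @[k --> \oo] --> (pi `^ (- t) : R).
Proof.
by rewrite -[X in _ --> X]mulr1; apply: cvgMr; exact: growth_ratio_cvg1.
Qed.

Lemma summand_denominator_cvg : u (q k) @[k --> \oo] --> (pi `^ (- t) : R).
Proof.
have h := scaled_growth_ratio_cvg.
have c : (1 + (q k)%:R / (q k.+1)%:R) `^ t @[k --> \oo] --> (1 + 0 : R) `^ t.
  apply: cvg_powR_seq; first by rewrite addr0.
  by apply: cvgD; [exact: cvg_cst|exact: denominator_ratio_cvg0].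
have dd : pi * dist_int ((q k)%:R * x) @[k --> \oo] --> (0 : R).
  rewrite -[X in _ --> X](mulr0 pi); apply: cvgMr.
  apply: (@squeeze_cvgr _ _ _ _ (cst 0) harmonic); last exact: cvg_harmonic.
    apply: nearW => k; rewrite dist_int_ge0 /= ltW //.
    rewrite (lt_trans (dist_denominator_lt t beta 0 k)) //.
    by rewrite ltf_pV2 ?posrE ?ltr0n ?denominator_gt0 // ltr_nat denominator_ge.
  exact: cvg_cst.
have e : cos (pi * dist_int ((q k)%:R * x)) `^ (- t) @[k --> \oo] --> (cos 0 : R) `^ (- t).
  apply: cvg_powR_seq; first by rewrite cos0.
  exact: (continuous_cvg _ (@continuous_cos R 0) dd).
rewrite addr0 powR1 in c; rewrite cos0 powR1 in e.
have hh := cvgM h (cvgM c e); rewrite !mulr1 in hh.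
pose f k := pi `^ (- t) * ((q k.+1)%:R `^ t / (q k)%:R `^ s) : R.
pose g k := f k * ((1 + (q k)%:R / (q k.+1)%:R) `^ t
                   * cos (pi * dist_int ((q k)%:R * x)) `^ (- t)).
apply: (@squeeze_cvgr _ _ _ _ f g).
- apply: nearW => k; rewrite [_ <= g k]summand_denominator_le // andbT.
  have /andP[/ltW h1 h2] := summand_denominator_ge beta 0 t_gt1 k.
  exact: le_trans h2.
- exact: h.
- exact: hh.
Qed.

End ZeroExponent.

Theorem proposition5p1 (R : realType) (t tau : R) (ht : 1 < t) (htau : 2 < tau) :
  let beta := tau - 1 in
  let s := t * beta in
  let a (r : R) (k : nat) : nat := partial_quotient t beta r k in
  let q (r : R) (k : nat) : nat := denominator t beta r k in
  let x (r : R) : R := xr t beta r in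
  let F (r : R) : \bar R := sine_series s t (x r) in
  let u (r : R) : R^nat := summand s t (x r) in
  let m (k : nat) : nat := (q 0 k).+1 in
  (* well-definedness, growth, irrationality exponent, convergence *)
  (forall r : R, 0 <= r ->
     (forall k, (1 <= k)%N -> (1 <= a r k)%N) /\
     cvgn (cf_convergent (a r) : R^nat) /\
     @irrational R (x r) /\
     (exists2 e : R^nat, e @ \oo --> (0 : R) &
        forall k, (q r k.+1)%:R `^ t / (q r k)%:R `^ s
                  = 1 / (k.+1)%:R `^ r * (1 + e k)) /\
     (ln (q r k.+1)%:R / ln (q r k)%:R : R) @[k --> \oo] --> beta /\
     irrationality_exponent (x r) = tau%:E /\
     ((F r < +oo)%E <-> 1 < r)) /\
  (* the cases r = 2 and r = 1 *)
  (irrationality_exponent (x 2) = tau%:E /\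
   irrationality_exponent (x 1) = tau%:E /\
   (F 2%R < +oo)%E /\ F 1%R = +oo%E) /\
  (* bound on the summands *)
  (forall r : R, 0 <= r ->
     (forall k n : nat, (q r k <= n < q r k.+1)%N ->
        dist_int (n%:R * x r) >= dist_int ((q r k)%:R * x r) /\
        dist_int ((q r k)%:R * x r) > 1 / ((q r k.+1)%:R + (q r k)%:R) /\
        1 / (n%:R `^ s * `|sin (pi * n%:R * x r)| `^ t)
        <= ((q r k.+1)%:R + (q r k)%:R) `^ t / (2 `^ t * (q r k)%:R `^ s)) /\
     (fun k => ((q r k.+1)%:R + (q r k)%:R) `^ t / (2 `^ t * (q r k)%:R `^ s) : R)
       =O_\oo (fun k => (k.+1)%:R `^ (- r) : R)) /\
  (forall r : R, 0 < r ->
     (((q r k.+1)%:R + (q r k)%:R) `^ t / (2 `^ t * (q r k)%:R `^ s) : R)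
       @[k --> \oo] --> (0 : R) /\
     u r @ \oo --> (0 : R)) /\
  (* the case r = 0 *)
  ~ (u 0 @ \oo --> (0 : R)) /\
  (forall k,
     1 / ((q 0 k)%:R `^ s * `|sin (pi * (q 0 k)%:R * x 0)| `^ t)
     >= pi `^ (- t) * (1 / ((q 0 k)%:R `^ s * dist_int ((q 0 k)%:R * x 0) `^ t)) /\
     pi `^ (- t) * (1 / ((q 0 k)%:R `^ s * dist_int ((q 0 k)%:R * x 0) `^ t))
     > pi `^ (- t) * ((q 0 k.+1)%:R `^ t / (q 0 k)%:R `^ s)) /\
  (pi `^ (- t) * ((q 0 k.+1)%:R `^ t / (q 0 k)%:R `^ s)) @[k --> \oo]
    --> (pi `^ (- t) : R) /\
  u 0 (q 0 k) @[k --> \oo] --> (pi `^ (- t) : R) /\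
  dist_int ((m k)%:R * x 0) @[k --> \oo] --> dist_int (x 0) /\
  dist_int (x 0) > 0 /\
  u 0 (m k) @[k --> \oo] --> (0 : R) /\
  subsequential_limit (u 0) (pi `^ (- t)) /\
  subsequential_limit (u 0) 0 /\
  pi `^ (- t) != 0 :> R /\
  ~ cvgn (u 0).
Proof.
move=> beta s a q x F u m.
have beta1 : 1 < beta by rewrite /beta; lra.
have beta_tau : beta + 1 = tau by rewrite /beta subrK.
have a0 r k : (0 < k)%N -> (0 < a r k)%N by exact: partial_quotient_gt0.
have expo r : 0 <= r -> irrationality_exponent (x r) = tau%:E.
  by move=> r0; rewrite /x irrationality_exponentE ?beta_tau.
have Fiff r : 0 <= r -> (F r < +oo)%E <-> 1 < r.
  move=> r0; split=> [Fr|]; last exact: sine_series_lty.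
  rewrite ltNge; apply/negP => r1.
  by move: Fr; rewrite /F sine_series_pinfty // ltxx.
have piN0 : pi `^ (- t) != 0 :> R by rewrite gt_eqF // powR_gt0 // pi_gt0.
have lim_q : subsequential_limit (u 0) (pi `^ (- t)).
  by exists (q 0); [exact: denominator_homo|exact: summand_denominator_cvg].
have lim_m : subsequential_limit (u 0) 0.
  exists m; last exact: summand_denominatorS_cvg0.
  by move=> i j ij; rewrite /m ltnS denominator_homo.
split.
  move=> r r0; do !split.
  - exact: a0.
  - exact: (cf_convergent_is_cvg (a0 r)).
  - exact: (irrational_cf_value (a0 r)).
  - exists (fun k => growth_defect t beta r k `^ t - 1).
      rewrite -(subrr 1); apply: cvgB; last exact: cvg_cst.
      exact: growth_defect_powR_cvg1.
    by move=> k; rewrite growth_ratioE // addrC subrK mulrC powRN mul1r.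
  - exact: ln_denominator_ratio_cvg.
  - exact: expo.
  - by move/(Fiff _ r0).
  - by move/(Fiff _ r0).
split.
  split; first exact: expo; split; first exact: expo.
  by split; [apply/Fiff => //; rewrite ltr1n|rewrite /F sine_series_pinfty].
split.
  move=> r r0; split.
    move=> k n kn; split.
      apply: dist_denominator_min => //; move/andP: kn => [kn ->].
      by rewrite andbT (leq_trans _ kn) // denominator_gt0.
    split; first by rewrite div1r; exact: dist_denominator_gt.
    by rewrite -summandE; exact: summand_le_bound.
  have [M M0 hM] := bound_bigO ht beta1 r0.
  apply/eqO_exP; exists M => //; apply: nearW => k /=.
  by rewrite !ger0_norm ?powR_ge0 ?hM // bound_ge0.
split.
  move=> r r0; have r0' := ltW r0.
  by split; [exact: bound_cvg0|exact: summand_cvg0].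
split.
  by move=> /subsequential_limit_unique/(_ lim_q)/eqP; apply/negP.
split.
  move=> k; have /andP[h1 h2] := summand_denominator_ge beta 0 ht k.
  by split=> //; rewrite -summandE.
split; first exact: scaled_growth_ratio_cvg.
split; first exact: summand_denominator_cvg.
split; first exact: dist_denominatorS_cvg.
split; first exact: dist_int_xr_gt0.
split; first exact: summand_denominatorS_cvg0.
do 3 (split; first by []).
(* A limit of the whole sequence would equal both subsequential limits, pi^(-t) and 0. *)
move=> /cvg_ex[l ul]; move/eqP: piN0; apply.
rewrite (subsequential_limit_unique ul lim_q).
by rewrite -(subsequential_limit_unique ul lim_m).
Qed.
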